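(* Let $\varepsilon\in(0,1)$ and let $T\sim T\left(n,\frac{1+\varepsilon}{n}\right)$. Then with high probability (as $n\to\infty$), $\mathrm{Dist}_{\mathrm{Tour\text{-}BP}}(T)=\Theta(\varepsilon^3)\,n$; that is, there are absolute constants $0<c_1\le c_2$ such that w.h.p. $c_1\varepsilon^3 n\le \mathrm{Dist}_{\mathrm{Tour\text{-}BP}}(T)\le c_2\varepsilon^3 n$.
   Context: For $p\in[0,1]$, the $p$-random tournament $T\sim T(n,p)$ on vertex set $[n]$ is obtained by orienting, independently for every $1\le i<j\le n$, the edge $\{i,j\}$ as $\overrightarrow{ji}$ with probability $p$ and as $\overrightarrow{ij}$ with probability $1-p$. A tournament is $2$-colorable (bipartite) if its vertex set can be partitioned into two sets each inducing a transitive subtournament. $\mathrm{Dist}_{\mathrm{Tour\text{-}BP}}(T)$ is the minimum number of arcs of $T$ that must be reversed to make $T$ $2$-colorable. *)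

(* Defs.v *)
From HB Require Import structures.
From mathcomp Require Import all_boot all_order all_algebra.
From mathcomp Require Import all_reals.

Set Implicit Arguments.
Unset Strict Implicit.
Unset Printing Implicit Defensive.

Import Order.TTheory GRing.Theory Num.Theory.

Local Open Scope ring_scope.

(* [(x, y) \in A] is the arc oriented from [x] to [y]. *)
Definition is_tournament (V : finType) (A : {set V * V}) : bool :=
  [forall x, (x, x) \notin A] &&
  [forall x, forall y, (x != y) ==> (((x, y) \in A) (+) ((y, x) \in A))].

Record tournament (V : finType) := Tournament {
  arcs :> {set V * V};
  tournamentP : is_tournament arcs }.

HB.instance Definition _ (V : finType) := [isSub for @arcs V].
HB.instance Definition _ (V : finType) := [Finite of tournament V by <:].

Definition transitive_on (V : finType) (A : {set V * V}) (X : {set V}) : bool :=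
  [forall x in X, forall y in X, forall z in X,
    ((x, y) \in A) && ((y, z) \in A) ==> ((x, z) \in A)].

Definition two_colorable (V : finType) (A : {set V * V}) : bool :=
  [exists X : {set V}, transitive_on A X && transitive_on A (~: X)].

Definition swap_arc (V : finType) (a : V * V) : V * V := (a.2, a.1).

Definition reverse (V : finType) (A S : {set V * V}) : {set V * V} :=
  (A :\: S) :|: [set swap_arc a | a in S].

Lemma in_reverse (V : finType) (A S : {set V * V}) (x y : V) :
  ((x, y) \in reverse A S) =
  ((x, y) \in A) && ((x, y) \notin S) || ((y, x) \in S).
Proof.
rewrite !inE andbC; congr orb.
apply/imsetP/idP => [[[a b] abS [-> ->]] //|yxS]; by exists (y, x).
Qed.

Lemma reverse_tournament (V : finType) (T : tournament V) (S : {set V * V}) :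
  S \subset T -> is_tournament (reverse T S).
Proof.
move=> /subsetP ST; have /andP[/forallP irr /forallP tot] := tournamentP T.
apply/andP; split; apply/forallP => x.
  rewrite in_reverse (negbTE (irr x)) /=.
  by apply: contra (irr x) => /ST.
apply/forallP => y; apply/implyP => xy; rewrite !in_reverse.
have /forallP/(_ y)/implyP/(_ xy) := tot x.
move: (ST (x, y)) (ST (y, x)).
case: ((x, y) \in S) => [/(_ isT) ->|_]; case: ((y, x) \in S) => [/(_ isT) ->|_] //=.
- by case: ((y, x) \in arcs T).
- by case: ((x, y) \in arcs T).
by case: ((x, y) \in arcs T); case: ((y, x) \in arcs T).
Qed.

(* Reversing every arc that goes down in a fixed enumeration of [V] makes the
   tournament transitive, so the minimum in [dist_BP] is over a nonempty set. *)
Lemma dist_BP_subproof (V : finType) (T : tournament V) :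
  exists k : nat, [exists S : {set V * V},
    [&& S \subset T, #|S| == k & two_colorable (reverse T S)]].
Proof.
pose S := [set a in arcs T | (enum_rank a.2 < enum_rank a.1)%N].
exists #|S|; apply/existsP; exists S; rewrite eqxx /=; apply/andP; split.
  by apply/subsetP => a; rewrite inE => /andP[].
have /andP[/forallP irr /forallP tot] := tournamentP T.
have E x y : ((x, y) \in reverse T S) = (enum_rank x < enum_rank y)%N.
  rewrite in_reverse !inE /=; have [<-|xy] := eqVneq x y.
    by rewrite (negbTE (irr x)) ltnn.
  have /forallP/(_ y)/implyP/(_ xy) := tot x.
  have : enum_rank x != enum_rank y :> nat.
    by apply: contra xy => /eqP/val_inj/enum_rank_inj ->.
  by case: ltngtP => // _ _; case: ((x, y) \in arcs T); case: ((y, x) \in arcs T).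
apply/existsP; exists setT; apply/andP; split;
  apply/forall_inP => x _; apply/forall_inP => y _; apply/forall_inP => z _;
  by rewrite !E; apply/implyP => /andP[]; apply: ltn_trans.
Qed.

Definition dist_BP (V : finType) (T : tournament V) : nat :=
  ex_minn (dist_BP_subproof T).

(* The law of T(n, p), with vertex set [{0, ..., n - 1}]: independently for each
   pair [i < j], the arc is [(j, i)] with probability [p]. *)
Definition tour_pmf (R : realType) (n : nat) (p : R) (T : tournament 'I_n) : R :=
  \prod_(i < n) \prod_(j < n | (i < j)%N)
    (if (j, i) \in arcs T then p else 1 - p).

Definition tour_prob (R : realType) (n : nat) (p : R)
    (E : pred (tournament 'I_n)) : R :=
  \sum_(T : tournament 'I_n | E T) tour_pmf p T.

(* [f (i, j)], for [i < j], says that the arc between [i] and [j] is [(j, i)]. *)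
Definition orient_arcs (n : nat) (f : {ffun 'I_n * 'I_n -> bool}) :
    {set 'I_n * 'I_n} :=
  [set a : 'I_n * 'I_n | ((a.1 < a.2)%N && ~~ f a)
                      || ((a.2 < a.1)%N && f (a.2, a.1))].

Lemma orient_arcsP (n : nat) (f : {ffun 'I_n * 'I_n -> bool}) :
  is_tournament (orient_arcs f).
Proof.
apply/andP; split; apply/forallP => x; first by rewrite inE /= ltnn.
apply/forallP => y; apply/implyP; rewrite !inE -val_eqE /=.
by case: ltngtP => //= _ _; rewrite ?orbF; case: (f _).
Qed.

Lemma tour_prob_total (R : realType) (n : nat) (p : R) :
  tour_prob p (fun _ : tournament 'I_n => true) = 1.
Proof.
pose P (q : 'I_n * 'I_n) := (q.1 < q.2)%N.
pose F (b : bool) : R := if b then p else 1 - p.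
have FE T : tour_pmf p T = \prod_(q | P q) F ((q.2, q.1) \in arcs T).
  by rewrite /tour_pmf pair_big_dep.
have -> : 1 = \prod_(q : 'I_n * 'I_n | P q) \sum_(b : bool | true) F b :> R.
  by rewrite big1 // => q _; rewrite big_bool /F /= addrC subrK.
rewrite (big_distr_big_dep false) /=.
pose h (f : {ffun 'I_n * 'I_n -> bool}) := Tournament (orient_arcsP f).
pose g (T : tournament 'I_n) : {ffun 'I_n * 'I_n -> bool} :=
  [ffun q => P q && ((q.2, q.1) \in arcs T)].
have gK T : h (g T) = T.
  apply/val_inj/setP => -[x y]; rewrite inE /= !ffunE /P /=.
  have /andP[/forallP irr /forallP tot] := tournamentP T.
  have [<-|xy] := eqVneq x y; first by rewrite (negbTE (irr x)) ltnn.
  have /forallP/(_ y)/implyP/(_ xy) := tot x.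
  move: xy; rewrite -val_eqE /=.
  by case: ltngtP => //= _ _; case: ((x, y) \in arcs T); case: ((y, x) \in arcs T).
rewrite /tour_prob (reindex_onto h g) /=; last by move=> T _; exact: gK.
apply: eq_big => [f|f _]; last first.
  rewrite FE; apply: eq_bigr => q Pq; rewrite inE /=.
  by move: Pq; rewrite /P => Pq; rewrite Pq ltnNge ltnW //=; case: q Pq.
apply/eqP/pfamilyP => [<-|[sf _]].
  split=> [|//]; apply/subsetP => q.
  by rewrite !inE ffunE; case Pq: (P q); rewrite ?eqxx // => _; exact: Pq.
apply/ffunP => q; rewrite ffunE inE /=.
case Pq: (P q) => /=; last first.
  apply/esym/negbTE/negP => fq; have := subsetP sf q.
  rewrite inE fq => /(_ isT) qP.
  by have : P q := qP; rewrite Pq.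
by move: Pq; rewrite /P => Pq; rewrite Pq ltnNge ltnW //=; case: q Pq.
Qed.

(* Main.v *)
(* Let B be the graph of backward arcs, so B ~ G(n, p).

   Up to a term that is o(n) in mean and a factor 3, Dist(T) is the number of
   edges to delete to make B bipartite. Deleting the edges inside the classes of
   a 2-colouring of B makes both classes transitive. Conversely, if T with k arcs
   reversed has transitive classes, then a backward arc ij that survives inside a
   class forces every vertex of the class between i and j to be a backward
   neighbour of i or of j, and B has few edges with this property.

   An arm is a simple path of length k from a given vertex. Conditioning on the
   graph outside the vertex gives a recursion in k for the probability of an arm:
   it is eventually below 4(np - 1) + eta, and when np = 1 + e it stays above e/2.
   Two arms are almost independent, by the van den Berg-Kesten inequality and the
   rarity of short connections.

   Upper bound: adding the edges one at a time, only an edge with connected ends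
   costs anything, and two vertices are connected with probability O(eps^2) + o(1).
   The edges of a subgraph G(n, 1/n) therefore cost o(n), and the remaining eps n/2
   or so cost O(eps^3) n.

   Lower bound: in G(n, (1 + eps/2)/n) about eps n vertices lie in components larger
   than s ~ 1/eps^2, which can be cut into about eps n/s connected pieces of size
   about s. A colouring with few monochromatic edges is determined up to a flip
   on most pieces, which leaves 3^(eps n/s) cases; in each of them order eps^3 n of
   the remaining random edges are monochromatic, except with a probability small
   enough for the union bound.

   Finally Dist(T) is 1-Lipschitz in the arcs, so its variance is O(n), and it is
   enough to know the order of its mean. *)

Require Import Defs.
From HB Require Import structures.
From mathcomp Require Import all_boot all_order all_algebra.
From mathcomp Require Import reals ring lra zify.
From mathcomp Require sequences exp.

Set Implicit Arguments.
Unset Strict Implicit.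
Unset Printing Implicit Defensive.

Import Order.TTheory GRing.Theory Num.Theory.

Local Open Scope ring_scope.

(** * Independent edges *)

(* [Ex p es f A] is the expectation of [f (A :|: S)], where [S] contains each
   item of [es] independently with probability [p]. *)
Fixpoint Ex (R : realType) (T : finType) (p : R) (es : seq T)
    (f : {set T} -> R) (A : {set T}) : R :=
  if es is e :: es' then (1 - p) * Ex p es' f A + p * Ex p es' f (e |: A)
  else f A.

(** Only sets reached from [A] by adding items of [es] matter, so comparing [f] and [g] under an
    invariant kept by such additions is enough. *)
Lemma Ex_le_inv (R : realType) (T : finType) (p : R) (es : seq T)
    (I : {set T} -> Prop) (f g : {set T} -> R) (A : {set T}) :
  0 <= p <= 1 -> (forall e B, e \in es -> I B -> I (e |: B)) ->
  (forall B, I B -> f B <= g B) -> I A -> Ex p es f A <= Ex p es g A.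
Proof.
move=> /andP[p0 p1] IU fg; elim: es A IU => [|e es IH] A IU IA /=; first exact: fg.
have IU' e' B : e' \in es -> I B -> I (e' |: B).
  by move=> e'es; apply: IU; rewrite inE e'es orbT.
have IeA : I (e |: A) by apply: IU => //; rewrite mem_head.
by apply: lerD; apply: ler_wpM2l; rewrite ?subr_ge0 //; apply: IH.
Qed.

Lemma Ex_eq_inv (R : realType) (T : finType) (p : R) (es : seq T)
    (I : {set T} -> Prop) (f g : {set T} -> R) (A : {set T}) :
  (forall e B, e \in es -> I B -> I (e |: B)) ->
  (forall B, I B -> f B = g B) -> I A -> Ex p es f A = Ex p es g A.
Proof.
move=> IU fg; elim: es A IU => [|e es IH] A IU IA /=; first exact: fg.
have IU' e' B : e' \in es -> I B -> I (e' |: B).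
  by move=> e'es; apply: IU; rewrite inE e'es orbT.
have IeA : I (e |: A) by apply: IU => //; rewrite mem_head.
by rewrite !IH.
Qed.

Section Expectation.
Variables (R : realType) (T : finType).
Implicit Types (p : R) (es : seq T) (f g : {set T} -> R) (A B C D I J : {set T}).

Lemma eq_Ex p es f g A : f =1 g -> Ex p es f A = Ex p es g A.
Proof. by move=> fg; apply: (@Ex_eq_inv _ _ _ _ (fun=> True)). Qed.

Lemma Ex_le p es f g A : 0 <= p <= 1 -> (forall B, f B <= g B) ->
  Ex p es f A <= Ex p es g A.
Proof. by move=> p01 fg; apply: (@Ex_le_inv _ _ _ _ (fun=> True)). Qed.

Lemma Ex_cst p es (c : R) A : Ex p es (fun=> c) A = c.
Proof. by elim: es A => //= e es IH A; rewrite !IH; ring. Qed.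

Lemma ExD p es f g A :
  Ex p es (fun B => f B + g B) A = Ex p es f A + Ex p es g A.
Proof. by elim: es A => //= e es IH A; rewrite !IH; ring. Qed.

Lemma ExZ p es (c : R) f A : Ex p es (fun B => c * f B) A = c * Ex p es f A.
Proof. by elim: es A => //= e es IH A; rewrite !IH; ring. Qed.

Lemma Ex_sum p es (I : Type) (r : seq I) (P : pred I) (F : I -> {set T} -> R) A :
  Ex p es (fun B => \sum_(i <- r | P i) F i B) A =
  \sum_(i <- r | P i) Ex p es (F i) A.
Proof.
elim: r => [|i r IH].
  by rewrite big_nil -[RHS](Ex_cst p es 0 A); apply: eq_Ex => B; rewrite big_nil.
rewrite big_cons -IH; case: ifP => Pi; rewrite -?ExD; apply: eq_Ex => B;
  by rewrite big_cons Pi.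
Qed.

Lemma Ex_ge0 p es f A : 0 <= p <= 1 -> (forall B, 0 <= f B) -> 0 <= Ex p es f A.
Proof. by move=> p01 f0; rewrite -(Ex_cst p es 0 A); apply: Ex_le. Qed.

Lemma Ex_cat p es1 es2 f A : Ex p (es1 ++ es2) f A = Ex p es1 (Ex p es2 f) A.
Proof. by elim: es1 A => //= e es IH A; rewrite !IH. Qed.

Lemma Ex_shift p es f A B : Ex p es f (A :|: B) = Ex p es (fun C => f (A :|: C)) B.
Proof.
elim: es B => //= e es IH B; by rewrite setUCA !IH.
Qed.

Lemma Ex_shift1 p es f e B : Ex p es f (e |: B) = Ex p es (fun C => f (e |: C)) B.
Proof. exact: Ex_shift. Qed.

Lemma Ex_perm p es1 es2 f A : perm_eq es1 es2 -> Ex p es1 f A = Ex p es2 f A.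
Proof.
have catC s1 s2 B : Ex p (s1 ++ s2) f B = Ex p (s2 ++ s1) f B.
  elim: s1 B => [|e s1 IH] B /=; first by rewrite cats0.
  rewrite !IH; elim: s2 B {IH} => //= e' s2 IH B.
  by rewrite -!IH (setUCA [set e']); ring.
elim: es1 es2 A => [|e es IH] es2 A; first by move=> /perm_size/esym/size0nil ->.
move=> pe; have : e \in es2 by rewrite -(perm_mem pe) mem_head.
move=> /splitPr es2E; move: pe; case: es2E => s1 s2 pe.
rewrite catC /= (IH (s2 ++ s1)) ?(IH (s2 ++ s1)) //;
rewrite -(perm_cons e) (permPl pe) perm_catC //=.
Qed.

Lemma Ex_indep p es f A :
  (forall e B, e \in es -> f (e |: B) = f B) -> Ex p es f A = f A.
Proof.
elim: es A => //= e es IH A fE.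
have fE' e' B : e' \in es -> f (e' |: B) = f B.
  by move=> e'es; apply: fE; rewrite inE e'es orbT.
by rewrite !IH // fE ?mem_head //; ring.
Qed.

(** Exposure in two independent rounds: an item is missing at the end exactly when both rounds miss
    it. *)
Lemma Ex_sprinkle p p1 p2 es f A : 1 - p = (1 - p1) * (1 - p2) ->
  Ex p es f A = Ex p1 es (Ex p2 es f) A.
Proof.
move=> pE; elim: es A => //= e es IH A.
rewrite !ExD !ExZ -(Ex_shift1 p1) !IH.
have -> : Ex p1 es (fun B => Ex p2 es f (e |: B)) (e |: A) =
          Ex p1 es (Ex p2 es f) (e |: A).
  rewrite (Ex_shift1 _ _ _ _ A) (Ex_shift1 _ _ (Ex p2 es f) _ A).
  by apply: eq_Ex => B; rewrite setUA setUid.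
have -> : p = 1 - (1 - p1) * (1 - p2) by rewrite -pE; ring.
by rewrite !(Ex_shift1 _ _ _ e A); ring.
Qed.

Lemma Ex_incr_set p es f A B : 0 <= p <= 1 ->
  (forall C D, C \subset D -> f C <= f D) -> A \subset B ->
  Ex p es f A <= Ex p es f B.
Proof.
move=> p01 fi AB; rewrite -(setU0 A) -(setU0 B) !Ex_shift.
by apply: Ex_le => // C; apply: fi; apply: setSU.
Qed.

Lemma Ex_cons_incr p e es f A : 0 <= p <= 1 ->
  (forall C D, C \subset D -> f C <= f D) -> Ex p es f A <= Ex p (e :: es) f A.
Proof.
move=> p01 fi /=; have := Ex_incr_set es p01 fi (subsetUr [set e] A).
by case/andP: p01; nra.
Qed.

(** Every item of [I :\: A] must be drawn, and as [es] has no repetition each has at most one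
    chance. *)
Lemma Ex_subset_le p es (I A : {set T}) : 0 <= p <= 1 -> uniq es ->
  Ex p es (fun B => (I \subset B)%:R) A <= p ^+ #|I :\: A|.
Proof.
move=> p01; have /andP[p0 p1] := p01; elim: es A => [|e es IH] A /=.
  have [IA _|_ _] := boolP (I \subset A); last exact: exprn_ge0.
  by rewrite (eqP (_ : I :\: A == set0)) ?cards0 // setD_eq0.
move=> /andP[ees ues]; have := IH (e |: A) ues.
have [eIA|eIA] := boolP (e \in I :\: A); last first.
  have -> : I :\: (e |: A) = I :\: A.
    apply/setP => x; rewrite !inE; have [->|//] := eqVneq x e.
    by move: eIA; rewrite inE => /negbTE ->.
  have := IH A ues; set X := _ ^+ _ => H1 H2.
  have p1' : 0 <= 1 - p by lra.
  by have := ler_wpM2l p1' H1; have := ler_wpM2l p0 H2; lra.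
have -> : Ex p es (fun B => (I \subset B)%:R) A = 0.
  rewrite -[RHS](Ex_cst p es 0 A).
  apply: (@Ex_eq_inv _ _ _ _ (fun B => e \notin B)).
  - move=> e' B e'es eB; rewrite !inE negb_or eB andbT.
    by apply: contraNneq ees => ->.
  - move=> B eB; case: (boolP (I \subset B)) => // /subsetP/(_ e).
    by rewrite (negbTE eB); move: eIA; rewrite inE => /andP[_ ->] /(_ isT).
  - by move: eIA; rewrite inE => /andP[].
have -> : #|I :\: A| = #|I :\: (e |: A)|.+1.
  rewrite (cardsD1 e) eIA add1n; congr (_.+1); apply: eq_card => x.
  by rewrite !inE; case: (x == e).
by rewrite exprS mulr0 add0r => H; apply: ler_wpM2l.
Qed.

Lemma Ex_jensen p es f A : 0 <= p <= 1 ->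
  (Ex p es f A) ^+ 2 <= Ex p es (fun B => f B ^+ 2) A.
Proof.
move=> p01; have /andP[p0 p1] := p01; elim: es A => //= e es IH A.
have := IH A; have := IH (e |: A); rewrite !expr2.
set m := Ex p es f A; set m' := Ex p es f (e |: A) => H1 H2.
have : 0 <= p * (1 - p) * (m - m') ^+ 2.
  by rewrite mulr_ge0 ?sqr_ge0 // mulr_ge0 // subr_ge0.
by rewrite expr2; nra.
Qed.

Lemma Ex_lipschitz p es f A e : 0 <= p <= 1 ->
  (forall e B, `|f (e |: B) - f B| <= 1) ->
  `|Ex p es f (e |: A) - Ex p es f A| <= 1.
Proof.
move=> /andP[p0 p1] fL; elim: es A => [|e' es IH] A; first exact: fL.
rewrite /= setUCA; have := IH A; have := IH (e' |: A).
by rewrite !ler_norml; nra.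
Qed.

(** Each item adds the variance [p * (1 - p) * (m' - m) ^+ 2] of the two conditional means, which
    differ by at most 1. *)
Lemma Ex_variance p es f A : 0 <= p <= 1 ->
  (forall e B, `|f (e |: B) - f B| <= 1) ->
  Ex p es (fun B => f B ^+ 2) A <= (Ex p es f A) ^+ 2 + p * (size es)%:R.
Proof.
move=> p01 fL; have /andP[p0 p1] := p01.
elim: es A => [|e es IH] A /=; first by rewrite mulr0 addr0.
have := IH A; have := IH (e |: A); have := Ex_lipschitz es A e p01 fL.
set m := Ex p es f A; set m' := Ex p es f (e |: A).
set s := Ex p es _ A; set s' := Ex p es _ (e |: A).
rewrite -natr1; set N := (size es)%:R => L H1 H2.
have L2 : (m' - m) ^+ 2 <= 1 by rewrite -real_normK ?num_real // expr_le1.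
have : p * (1 - p) * (m' - m) ^+ 2 <= p * (1 - p).
  by rewrite ler_piMr // mulr_ge0 // subr_ge0.
have : p * (1 - p) <= p by nra.
move: H1 H2; rewrite !expr2 => H1 H2.
have := ler_wpM2l p0 H1; have p1' : 0 <= 1 - p by lra.
have := ler_wpM2l p1' H2; lra.
Qed.

Lemma Ex_markov p es f A (a : R) : 0 <= p <= 1 -> 0 < a -> (forall B, 0 <= f B) ->
  Ex p es (fun B => (a <= f B)%R%:R) A <= Ex p es f A / a.
Proof.
move=> p01 a0 f0; rewrite mulrC -ExZ; apply: Ex_le => // B.
rewrite mulrC ler_pdivlMr //; case: (boolP (a <= f B)) => [|_].
  by rewrite mul1r.
by rewrite mul0r.
Qed.

Lemma Ex_chebyshev p es f A (a : R) : 0 <= p <= 1 -> 0 < a ->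
  (forall e B, `|f (e |: B) - f B| <= 1) ->
  Ex p es (fun B => (a <= `|f B - Ex p es f A|)%R%:R) A <= p * (size es)%:R / a ^+ 2.
Proof.
move=> p01 a0 fL; set m := Ex p es f A.
have -> : Ex p es (fun B => (a <= `|f B - m|)%R%:R) A =
          Ex p es (fun B => (a ^+ 2 <= (f B - m) ^+ 2)%R%:R) A.
  apply: eq_Ex => B; rewrite -(real_normK (num_real (f B - m))).
  by rewrite ler_pXn2r // nnegrE ?normr_ge0 // ltW.
apply: le_trans (Ex_markov _ _ p01 (exprn_gt0 2 a0) _) _.
  by move=> B; exact: sqr_ge0.
rewrite ler_pM2r ?invr_gt0 ?exprn_gt0 //.
rewrite (@eq_Ex _ _ _ (fun B => f B ^+ 2 + ((- 2 * m) * f B + m ^+ 2))); last first.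
  by move=> B /=; ring.
rewrite !ExD Ex_cst ExZ -/m; have := Ex_variance es A p01 fL; rewrite -/m.
by rewrite expr2; lra.
Qed.

(** * Disjoint occurrence of increasing events *)

(** A witness is a set of present items on which the event already holds; for increasing events this
    is the usual disjoint occurrence. *)
Definition box (a b : pred {set T}) : pred {set T} :=
  fun B => [exists I : {set T}, exists J : {set T},
    [&& I \subset B, J \subset B, [disjoint I & J], a I & b J]].

Definition monotone_pred (a : pred {set T}) := forall I J, I \subset J -> a I -> a J.

Lemma boxP (a b : pred {set T}) B :
  reflect (exists I J : {set T},
    [/\ I \subset B, J \subset B, [disjoint I & J], a I & b J]) (box a b B).
Proof.
apply: (iffP existsP) => [[I /existsP[J /and5P[]]]|[I [J [*]]]].
  by exists I, J.
by exists I; apply/existsP; exists J; apply/and5P.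
Qed.

Lemma incr_section a e : monotone_pred a -> monotone_pred (fun B => a (e |: B)).
Proof. by move=> ia I J IJ; apply: ia; apply: setUS. Qed.

(** The item [e] lies in at most one of two disjoint witnesses, so only one of the two events needs
    it for free. *)
Lemma box_section_sub a b e B : monotone_pred a -> monotone_pred b -> box a b (e |: B) ->
  box (fun B => a (e |: B)) b B || box a (fun B => b (e |: B)) B.
Proof.
move=> ia ib /boxP[I [J [IB JB D aI bJ]]].
have sD (K : {set T}) : K \subset e |: B -> K :\ e \subset B by rewrite subDset.
have sN (K : {set T}) : e \notin K -> K \subset e |: B -> K \subset B.
  by move=> eK /sD; rewrite (setDidPl _) // disjoint_sym disjoints1.
have [eI|eI] := boolP (e \in I); apply/orP; [left|right]; apply/boxP.
  have eJ : e \notin J by have/disjointFr/(_ eI) -> := D.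
  exists (I :\ e), J; rewrite setD1K //; split=> //; [exact: sD|exact: sN|].
  by apply: disjointWl D; apply: subsetDl.
exists I, (J :\ e); split=> //; [exact: sN|exact: sD| |].
  by apply: disjointWr D; apply: subsetDl.
by apply: ib bJ; rewrite -subDset.
Qed.

(* The van den Berg-Kesten inequality for increasing events; the restriction
   [p <= 1/2] makes a plain induction on the coordinates go through. *)
Lemma BK p es a b : 0 <= p <= 1 / 2 -> monotone_pred a -> monotone_pred b ->
  Ex p es (fun B => (box a b B)%:R) set0 <=
  Ex p es (fun B => (a B)%:R) set0 * Ex p es (fun B => (b B)%:R) set0.
Proof.
move=> /andP[p0 p2]; have p01 : 0 <= p <= 1 by apply/andP; split; lra.
elim: es a b => [|e es IH] a b ia ib /=.
  case: (boolP (box a b set0)) => [/boxP[I [J []]]|_]; last by rewrite mulr_ge0.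
  by rewrite !subset0 => /eqP -> /eqP -> _ -> ->; rewrite mulr1.
rewrite !(Ex_shift1 _ _ _ e).
set a0 := Ex p es (fun B => (a B)%:R) set0.
set b0 := Ex p es (fun B => (b B)%:R) set0.
set a1 := Ex p es (fun C => (a (e |: C))%:R) set0.
set b1 := Ex p es (fun C => (b (e |: C))%:R) set0.
have iae := incr_section (e := e) ia; have ibe := incr_section (e := e) ib.
have H1 := IH _ _ iae ib; have H2 := IH _ _ ia ibe; have H0 := IH _ _ ia ib.
have a01 : a0 <= a1.
  apply: Ex_le => // B; rewrite ler_nat.
  by case: (boolP (a B)) => // /(ia _ (e |: B)) -> //; apply: subsetUr.
have b01 : b0 <= b1.
  apply: Ex_le => // B; rewrite ler_nat.
  by case: (boolP (b B)) => // /(ib _ (e |: B)) -> //; apply: subsetUr.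
(* Pointwise: where [box a b B] holds both terms on the right are 1; elsewhere [box_section_sub]
   makes one of them 1. *)
have : Ex p es (fun B => (box a b (e |: B))%:R) set0
  + Ex p es (fun B => (box a b B)%:R) set0 <=
  Ex p es (fun B => (box (fun B => a (e |: B)) b B)%:R) set0
  + Ex p es (fun B => (box a (fun B => b (e |: B)) B)%:R) set0.
  rewrite -!ExD; apply: Ex_le => // B; rewrite -!natrD ler_nat.
  case: (boolP (box a b B)) => [/boxP[I [J [IB JB D aI bJ]]]|_].
    rewrite (_ : box (fun B => a (e |: B)) b B = true); last first.
      by apply/boxP; exists I, J; split=> //; apply: ia aI; apply: subsetUr.
    rewrite (_ : box a (fun B => b (e |: B)) B = true); last first.
      by apply/boxP; exists I, J; split=> //; apply: ib bJ; apply: subsetUr.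
    by rewrite leq_add2r leq_b1.
  case: (boolP (box a b (e |: B))) => // /(box_section_sub ia ib).
  by case/orP => ->; rewrite ?addn0 // leq_addl.
move: H0 H1 H2; rewrite -/a0 -/b0 -/a1 -/b1.
move: (Ex p es (fun B => (box a b B)%:R) set0) => x.
move: (Ex p es (fun B => (box a b (e |: B))%:R) set0) => x1.
move: (Ex p es _ set0) => x2; move: (Ex p es _ set0) => x3 H0 H1 H2 H3.
(* The left side is [(1 - 2 * p) * x + p * (x1 + x)], whose first weight is nonnegative as
   [p <= 1/2]. The product of the means exceeds the resulting bound by exactly this term. *)
have : 0 <= (a1 - a0) * (b1 - b0) * (p * p) by rewrite !mulr_ge0 ?subr_ge0.
have : (1 - 2 * p) * x <= (1 - 2 * p) * (a0 * b0) by apply: ler_wpM2l => //; lra.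
have : p * (x1 + x) <= p * (a1 * b0 + a0 * b1) by apply: ler_wpM2l => //; lra.
lra.
Qed.

Lemma Ex_avoid p es (G A : {set T}) :
  Ex p es (fun B => (B :&: G == set0)%:R) A =
  (A :&: G == set0)%:R * (1 - p) ^+ (count (mem G) es).
Proof.
elim: es A => [|e es IH] A /=; first by rewrite expr0 mulr1.
rewrite !IH setIUl setU_eq0 exprD /=.
rewrite (_ : ([set e] :&: G == set0) = (e \notin G)); last first.
  by rewrite setI_eq0 disjoints1.
by case: (e \in G) => /=; rewrite ?expr0 ?expr1; ring.
Qed.

End Expectation.

(** Unfolds the recursion into a product measure, the form in which the law of the tournament is
    given. *)
Lemma Ex_sum_sets (R : realType) (T : finType) (p : R) (es : seq T)
    (f : {set T} -> R) (A : {set T}) : uniq es ->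
  Ex p es f A = \sum_(S : {set T} | S \subset es)
    (\prod_(e <- es) (if e \in S then p else 1 - p)) * f (A :|: S).
Proof.
elim: es A => [|e es IH] A /=.
  move=> _; rewrite (big_pred1 set0) ?big_nil ?mul1r ?setU0 // => S.
  apply/idP/eqP => [/subsetP S0|->]; last by apply/subsetP => x; rewrite inE.
  by apply/setP => x; rewrite inE; apply/negP => /S0.
move=> /andP[ees ues]; rewrite !IH // [RHS](bigID (fun S : {set T} => e \in S)) /= [RHS]addrC.
congr (_ + _); rewrite big_distrr /=.
  apply: eq_big => [S|S /subsetP Ses]; last first.
    have eS : e \notin S by apply: contra ees => /Ses.
    by rewrite big_cons (negbTE eS) mulrA.
  apply/idP/andP => [/subsetP Ses|[/subsetP Ses eS]].
    split; last by apply: contra ees => /Ses.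
    by apply/subsetP => x xS; rewrite inE (Ses x xS) orbT.
  apply/subsetP => x xS; have := Ses x xS; rewrite inE.
    by case: eqP => // xe; rewrite -xe xS in eS.
rewrite [RHS](reindex_onto (fun S => e |: S) (fun S => S :\ e)) /=; last first.
  by move=> S /andP[_ eS]; rewrite setD1K.
apply: eq_big => [S|S Ses].
  rewrite setU11 andbT; apply/idP/andP => [/subsetP Ses|[/subsetP Ses /eqP SE]].
    split; last by rewrite setU1K //; apply: contra ees => /Ses.
    by apply/subsetP => x; rewrite !inE => /orP[->//|/Ses ->]; rewrite orbT.
  apply/subsetP => x xS; have := Ses x; rewrite !inE xS orbT => /(_ isT).
  by case: eqP => // xe; move: xS; rewrite -SE xe !inE eqxx.
rewrite big_cons setU11 mulrA setUCA setUA; congr (_ * _ * _).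
apply: eq_big_seq => x xes; rewrite !inE.
by case: eqP => // xe; rewrite -xe xes in ees.
Qed.

(** * Tournaments and their backward arcs *)

Lemma natr_dist_le1 (R : realType) (a b : nat) :
  (a <= b.+1)%N -> (b <= a.+1)%N -> `|a%:R - b%:R : R| <= 1.
Proof. by rewrite -!(ler_nat R) -!natr1 ler_norml; lra. Qed.

Section Graph.
Variable n : nat.
Local Notation V := 'I_n.
Local Notation graph := {set V * V}.
Implicit Types (A B P : graph) (X : {set V}) (x y : V).

Definition pairs : seq (V * V) := [seq q : V * V <- enum {: V * V} | (q.1 < q.2)%N].

Lemma mem_pairs (q : V * V) : (q \in pairs) = (q.1 < q.2)%N.
Proof. by rewrite mem_filter mem_enum andbT. Qed.

Lemma pairs_uniq : uniq pairs.
Proof. by rewrite filter_uniq ?enum_uniq. Qed.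

Definition edge x y : V * V := if (x < y)%N then (x, y) else (y, x).

Definition adj A x y := edge x y \in A.

Lemma edgeC x y : edge x y = edge y x.
Proof. by rewrite /edge; case: ltngtP => // /val_inj ->. Qed.

Lemma adjC A x y : adj A x y = adj A y x.
Proof. by rewrite /adj edgeC. Qed.

Lemma edge_pair x y : x != y -> ((edge x y).1 < (edge x y).2)%N.
Proof. by rewrite -val_eqE /edge; case: (ltngtP x y). Qed.

Lemma edge_mem_pairs x y : x != y -> edge x y \in pairs.
Proof. by rewrite mem_pairs; apply: edge_pair. Qed.

Lemma pair_edge (q : V * V) : (q.1 < q.2)%N -> edge q.1 q.2 = q.
Proof. by rewrite /edge => ->; case: q. Qed.

Lemma edge_inj x y x' y' : edge x y = edge x' y' ->
  (x = x' /\ y = y') \/ (x = y' /\ y = x').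
Proof. by rewrite /edge; do 2 case: ifP => _; case=> -> ->; tauto. Qed.

(* A graph [A] stands for its pairs [(i, j)] with [i < j]: the backward arcs. *)
Definition tourn A : tournament V := Tournament (orient_arcsP [ffun q => q \in A]).

Lemma in_tourn A x y : ((x, y) \in arcs (tourn A)) =
  (x < y)%N && ((x, y) \notin A) || (y < x)%N && ((y, x) \in A).
Proof. by rewrite inE /= !ffunE. Qed.

Definition back (S : graph) : graph := [set q : V * V | (q.1 < q.2)%N & (q.2, q.1) \in S].

Lemma tournE (T : tournament V) : tourn (back T) = T.
Proof.
apply/val_inj/setP => -[x y] /=; rewrite in_tourn !inE /=.
have /andP[/forallP irr /forallP tot] := tournamentP T.
have [<-|xy] := eqVneq x y; first by rewrite (negbTE (irr x)) ltnn.
have /forallP/(_ y)/implyP/(_ xy) := tot x.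
move: xy; rewrite -val_eqE /=.
by case: ltngtP => //= _ _; case: ((x, y) \in arcs T); case: ((y, x) \in arcs T).
Qed.

Lemma backE A : {in pairs, back (tourn A) =i A}.
Proof.
move=> [x y]; rewrite mem_pairs inE in_tourn /= => xy.
by rewrite xy ltnNge ltnW.
Qed.

(** [tourn] and [back] are inverse bijections between tournaments and sets of increasing pairs, and
    the weights agree factor by factor. *)
Lemma tour_probE (R : realType) (p : R) (E : pred (tournament V)) :
  tour_prob p E = Ex p pairs (fun A => (E (tourn A))%:R) set0.
Proof.
rewrite Ex_sum_sets ?pairs_uniq // /tour_prob big_mkcond /=.
rewrite [RHS](reindex_onto (fun T : tournament V => back T) tourn) /=.
  apply: eq_big => [T|T _].
    rewrite tournE eqxx andbT; apply/esym/subsetP => q.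
    by rewrite inE mem_pairs => /andP[].
  rewrite set0U tournE; case: ifP => _; rewrite ?mulr0 ?mulr1 //.
  rewrite /tour_pmf pair_big_dep /= big_filter big_enum_cond /=.
  by apply: eq_bigr => q qp; rewrite inE qp.
move=> A /subsetP Ap; apply/setP => q.
have [qp|qp] := boolP (q \in pairs); first exact: backE.
by rewrite inE -mem_pairs (negbTE qp); apply/esym/negbTE; apply: contra qp => /Ap.
Qed.

Definition pdiff A P : graph := [set q : V * V | (q.1 < q.2)%N & (q \in A) != (q \in P)].

(** Reversing the arcs of [tourn A] that are not arcs of [tourn P] gives [tourn P], and each of them
    comes from a different pair of [pdiff A P]. *)
Lemma dist_BP_le A P : two_colorable (tourn P) -> (dist_BP (tourn A) <= #|pdiff A P|)%N.
Proof.
move=> Pc; rewrite /dist_BP; case: ex_minnP => k _ kmin.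
pose S := [set a in arcs (tourn A) | a \notin arcs (tourn P)].
have inS a : (a \in S) = (a \in arcs (tourn A)) && (a \notin arcs (tourn P)).
  by rewrite in_set.
have RE : reverse (tourn A) S = tourn P.
  apply/setP => -[x y]; rewrite in_reverse !inS !in_tourn /=.
  have [E|xy] := eqVneq x y; first by rewrite E ltnn.
  move: xy; rewrite -val_eqE /=.
  case: ltngtP => //= _ _; case: (_ \in A); case: (_ \in P) => //.
apply: leq_trans (kmin #|S| _) _.
  apply/existsP; exists S; rewrite eqxx RE Pc !andbT.
  by apply/subsetP => a; rewrite inS => /andP[].
rewrite -(card_in_imset (f := fun a => edge a.1 a.2) (D := S)).
  apply/subset_leq_card/subsetP => q /imsetP[[x y] + ->].
  rewrite inS !in_tourn /= /edge !inE; case: (ltngtP x y) => //= xy.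
  - by rewrite xy !orbF; case: (_ \in A); case: (_ \in P).
  - by rewrite xy; case: (_ \in A); case: (_ \in P).
move=> [x y] [x' y'] H1 H2 /edge_inj[[/= -> ->]//|[/= E1 E2]].
rewrite -{}E1 -{}E2 in H2 *; move: H1 H2.
rewrite !inS !in_tourn /=; case: (ltngtP x y) => //= _.
- by case: (_ \in A).
- by case: (_ \in A).
Qed.

Lemma dist_BP_ex A : exists2 P, two_colorable (tourn P) & (#|pdiff A P| <= dist_BP (tourn A))%N.
Proof.
rewrite /dist_BP; case: ex_minnP => k /existsP[S /and3P[ST /eqP <- RS]] _.
exists (back (reverse (tourn A) S)).
  by rewrite (tournE (Tournament (reverse_tournament ST))).
(* A pair on which the graphs differ is sent to the reversed arc between its ends, which is in
   [S]. *)
rewrite -(card_in_imset (f := fun q => if q \in S then q else (q.2, q.1)) (D := pdiff _ _)).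
  apply/subset_leq_card/subsetP => q /imsetP[[x y] + ->].
  rewrite [_ \in pdiff _ _]in_set /= [_ \in back _]in_set /= in_reverse !in_tourn /=.
  case: (ltngtP x y) => //= _.
  by case: ifP => //; case: (_ \in A); case: ((y, x) \in S).
move=> [x y] [x' y']; rewrite 2![_ \in pdiff _ _]in_set /= => /andP[xy _] /andP[xy' _].
case: ifP => _; case: ifP => _ //= [E1 E2]; subst; rewrite ?E1 ?E2 //.
- by move: xy; rewrite ltnNge ltnW.
- by move: xy; rewrite ltnNge ltnW.
Qed.

Definition mono A X : graph :=
  [set q in A | (q.1 < q.2)%N && ((q.1 \in X) == (q.2 \in X))].

(** This is the number of edges to delete to make the graph bipartite. *)
Definition distB A : nat := #|mono A [arg min_(X < set0) #|mono A X|]|.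

Lemma distB_le A X : (distB A <= #|mono A X|)%N.
Proof. by rewrite /distB; case: arg_minnP => // Y _; apply. Qed.

Lemma distB_ex A : exists X, distB A = #|mono A X|.
Proof. by rewrite /distB; eexists. Qed.

(** Once the monochromatic edges are dropped, all arcs inside a class go forward, hence the class is
    transitive. *)
Lemma dist_BP_le_distB A : (dist_BP (tourn A) <= distB A)%N.
Proof.
have [X ->] := distB_ex A.
pose P := [set q in A | (q.1 \in X) != (q.2 \in X)].
apply: leq_trans (dist_BP_le A (P := P) _) _.
  have tr (Y : {set V}) : (forall x y, x \in Y -> y \in Y -> (x \in X) = (y \in X)) ->
      transitive_on (tourn P) Y.
    move=> YX; have E x y : x \in Y -> y \in Y -> ((x, y) \in arcs (tourn P)) = (x < y)%N.
      by move=> xY yY; rewrite in_tourn !inE /= (YX x y) // eqxx !andbF orbF andbT.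
    apply/forall_inP => x xY; apply/forall_inP => y yY; apply/forall_inP => z zY.
    by rewrite !E //; apply/implyP => /andP[]; apply: ltn_trans.
  apply/existsP; exists X; rewrite !tr // => x y; rewrite ?inE.
  - by move=> /negbTE -> /negbTE ->.
  - by move=> -> ->.
apply/subset_leq_card/subsetP => q; rewrite !inE => /andP[->].
by case: (q \in A); case: (q.1 \in X); case: (q.2 \in X).
Qed.

(** An optimal target for one of the two graphs serves the other, at the price of the single pair
    [q]. *)
Lemma dist_BP_lipschitz (R : realType) q A :
  `|(dist_BP (tourn (q |: A)))%:R - (dist_BP (tourn A))%:R : R| <= 1.
Proof.
have H A1 A2 : (forall e, e != q -> (e \in A1) = (e \in A2)) ->
    (dist_BP (tourn A1) <= (dist_BP (tourn A2)).+1)%N.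
  move=> A12; have [P Pc Pd] := dist_BP_ex A2.
  apply: leq_trans (dist_BP_le A1 Pc) _; apply: leq_trans (_ : (#|pdiff A2 P|.+1 <= _)%N) => //.
  rewrite -add1n -(cards1 q); apply: leq_trans (leq_card_setU _ _).
  apply/subset_leq_card/subsetP => e; rewrite !inE; have [->|eq] /= := eqVneq e q => //.
  by rewrite A12.
have H1 := H (q |: A) A _; have H2 := H A (q |: A) _.
have {}H1 : (dist_BP (tourn (q |: A)) <= (dist_BP (tourn A)).+1)%N.
  by apply: H1 => e eq; rewrite !inE (negbTE eq).
have {}H2 : (dist_BP (tourn A) <= (dist_BP (tourn (q |: A))).+1)%N.
  by apply: H2 => e eq; rewrite !inE (negbTE eq).
exact: natr_dist_le1.
Qed.

End Graph.

(** * Reversing arcs compared with deleting edges *)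

Section Comparison.
Variable n : nat.
Local Notation V := 'I_n.
Local Notation graph := {set V * V}.
Implicit Types (A B P S : graph) (X Y : {set V}) (x y v w : V) (L D : nat).
Local Open Scope nat_scope.

Definition nbrs A v : {set V} := [set w | (w != v) && adj A v w].

Definition deg A v := #|nbrs A v|.

Definition short L A : graph := [set q in A | (q.1 < q.2) && (q.2 < q.1 + L)].

Lemma sum_deg_le S : \sum_v deg S v <= 2 * #|S|.
Proof.
pose lo v := [set w in nbrs S v | w < v]; pose hi v := [set w in nbrs S v | v < w].
have degE v : deg S v <= #|lo v| + #|hi v|.
  apply: leq_trans (leq_card_setU _ _); apply/subset_leq_card/subsetP => w.
  rewrite !inE -val_eqE /=; case/andP=> + ->.
  by case: ltngtP => //=; rewrite ?orbT.
apply: (@leq_trans (\sum_v (#|lo v| + #|hi v|))); first exact: leq_sum.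
rewrite big_split mul2n -addnn; apply: leq_add.
  under eq_bigr do rewrite -sum1_card.
  rewrite pair_big_dep /= sum1dep_card.
  rewrite -(card_in_imset (f := fun q : V * V => (q.2, q.1))).
    apply/subset_leq_card/subsetP => q /imsetP[[x y] + ->].
    rewrite !inE /= /adj => /andP[/andP[_ +] xy].
    by rewrite edgeC /edge xy.
  by move=> [x y] [x' y'] _ _ [-> ->].
under eq_bigr do rewrite -sum1_card.
rewrite pair_big_dep /= sum1dep_card.
apply/subset_leq_card/subsetP => -[x y].
rewrite !inE /= /adj => /andP[/andP[_ +] xy].
by rewrite /edge xy.
Qed.

Lemma deg_triangle A P v : deg P v <= deg A v + deg (pdiff A P) v.
Proof.
apply: leq_trans (leq_card_setU _ _); apply/subset_leq_card/subsetP => w.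
rewrite !inE /adj; case/andP=> wv P1; rewrite wv /= !inE P1 edge_pair 1?eq_sym //=.
by case: (_ \in A).
Qed.

(** At a vertex with [D < deg P v], either [D <= 2 * deg A v], and the square of the degree pays for
    its edges, or more than half of [deg P v] comes from changed pairs, which then outnumber the
    edges of [A] at [v]. *)
Lemma heavy_edges_le A P D :
  D * #|[set q in A | (q.1 < q.2) && ((D < deg P q.1) || (D < deg P q.2))]| <=
  2 * \sum_v deg A v ^ 2 + 2 * D * #|pdiff A P|.
Proof.
have H1 : #|[set q in A | (q.1 < q.2) && ((D < deg P q.1) || (D < deg P q.2))]| <=
    \sum_(v | D < deg P v) deg A v.
  pose F1 := [set q in A | (q.1 < q.2) && (D < deg P q.1)].
  pose F2 := [set q in A | (q.1 < q.2) && (D < deg P q.2)].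
  pose G := [set q : V * V | (D < deg P q.1) && (q.2 \in nbrs A q.1)].
  have -> : \sum_(v | D < deg P v) deg A v = #|G|.
    under eq_bigr do rewrite /deg -sum1_card.
    by rewrite pair_big_dep /= sum1dep_card.
  pose g (q : V * V) := if D < deg P q.1 then q else (q.2, q.1).
  rewrite -[X in X <= _](card_in_imset (f := g)).
    apply/subset_leq_card/subsetP => q /imsetP[[x y] + ->].
    rewrite !inE /g /= /adj => /andP[xyA /andP[xy +]].
    have yx : y != x by rewrite -val_eqE /=; case: ltngtP xy.
    case: ifP => /= [-> _|_ /= ->]; first by rewrite yx /edge xy.
    by rewrite eq_sym yx /= edgeC /edge xy.
  move=> [x y] [x' y']; rewrite !inE /g /= => /andP[_ /andP[xy _]] /andP[_ /andP[xy' _]].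
  case: ifP => _; case: ifP => _ [E1 E2]; subst => //.
  - by move: xy; rewrite ltnNge ltnW.
  - by move: xy; rewrite ltnNge ltnW.
apply: leq_trans (leq_mul (leqnn D) H1) _.
apply: (@leq_trans (\sum_v (2 * deg A v ^ 2 + D * deg (pdiff A P) v))).
  rewrite big_distrr /= big_mkcond; apply: leq_sum => v _.
  case: ifP => // Dv; have := deg_triangle A P v.
  by case: (leqP D (2 * deg A v)) => H H'; nia.
rewrite big_split /= -!big_distrr leq_add2l -mulnA mulnCA leq_mul2l.
by rewrite sum_deg_le orbT.
Qed.

(* Cut ['I_n] into blocks of length [L]; each block holds at most [D + 1] points. *)
Lemma sparse_set_le (Z : {set V}) L D : 0 < L ->
  (forall i, i \in Z -> #|[set k in Z | (i < k) && (k < i + L)]| <= D) ->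
  #|Z| <= (n %/ L).+1 * D.+1.
Proof.
move=> L0 ZD.
have bP (i : V) : i %/ L < (n %/ L).+1 by rewrite ltnS leq_div2r // ltnW.
pose b (i : V) : 'I_(n %/ L).+1 := Ordinal (bP i).
rewrite -sum1_card (partition_big b xpredT) //=.
rewrite -[X in _ <= X * _]card_ord -sum_nat_const; apply: leq_sum => c _.
rewrite sum1dep_card; set W := [set _ | _].
have [->|[i0 i0W]] := set_0Vmem W; first by rewrite cards0.
pose i := [arg min_(i < i0 in W) (i : nat)].
have [iW imin] : i \in W /\ forall j, j \in W -> i <= j.
  by rewrite /i; case: arg_minnP.
rewrite (cardsD1 i) iW add1n ltnS; move: (iW); rewrite inE => /andP[iZ /eqP bi].
apply: leq_trans (ZD i iZ); apply/subset_leq_card/subsetP => j.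
rewrite !inE => /and3P[ji jZ /eqP bj]; rewrite jZ /=.
have ij : i <= j by apply: imin; rewrite inE jZ bj eqxx.
apply/andP; split; first by rewrite ltn_neqAle ij andbT eq_sym.
have E : i %/ L = j %/ L by have /(congr1 val) := etrans bi (esym bj).
move: (divn_eq i L) (divn_eq j L) (ltn_pmod j L0); rewrite E.
by move: (_ * L) (i %% L) (j %% L) => a b1 c1; lia.
Qed.

(* If the backward arc [xy] survives inside a class, every vertex of the class
   between [x] and [y] must be joined to [x] or to [y] by a backward arc. *)
Lemma transitive_between P Y x y k : transitive_on (tourn P) Y ->
  x \in Y -> y \in Y -> k \in Y -> (x < k) -> (k < y) -> (x, y) \in P ->
  adj P x k || adj P y k.
Proof.
move=> /forall_inP/(_ x) + xY yY kY xk ky xyP.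
move=> /(_ xY)/forall_inP/(_ k kY)/forall_inP/(_ y yY).
rewrite !in_tourn xk ky (ltn_trans xk ky) !ltnNge !(ltnW xk) !(ltnW ky).
rewrite (ltnW (ltn_trans xk ky)) /= !orbF xyP implybF negb_and !negbK.
rewrite (adjC P y k) /adj /edge xk ky.
by [].
Qed.

(** If [xy] is such an edge, any other left end within distance [L] after [x] lies between [x] and
    [y], so it is a neighbour of one of them, which leaves at most [2 * D] choices. The left ends
    are therefore sparse, and each carries at most [D] edges. *)
Lemma long_edges_le P Y L D : 0 < L -> transitive_on (tourn P) Y ->
  #|[set q in P | [&& q.1 + L <= q.2, q.1 \in Y, q.2 \in Y,
      deg P q.1 <= D & deg P q.2 <= D]]| <= (n %/ L).+1 * (2 * D).+1 * D.
Proof.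
move=> L0 Ytr; set M := [set _ in _ | _].
pose Z := [set q.1 | q in M].
have ZY i : i \in Z -> exists2 q, q \in M & i = q.1 by move=> /imsetP[q]; exists q.
have cZ : #|Z| <= (n %/ L).+1 * (2 * D).+1.
  apply: sparse_set_le L0 _ => i /ZY[[x y] + ->] /=.
  rewrite inE /= => /and5P[xyP xy xY yY /andP[dx dy]].
  apply: (@leq_trans #|nbrs P x :|: nbrs P y|); last first.
    by apply: leq_trans (leq_card_setU _ _) _; rewrite mul2n -addnn leq_add.
  apply/subset_leq_card/subsetP => k; rewrite !inE => /and3P[/ZY[[k' y']]].
  rewrite inE /= => /and5P[_ _ k'Y _ _] -> xk kx.
  have ky : k' < y by apply: leq_trans kx _.
  have := transitive_between Ytr xY yY k'Y xk ky xyP.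
  by rewrite -!val_eqE /= (gtn_eqF xk) (ltn_eqF ky).
apply: leq_trans (_ : \sum_(i in Z) deg P i * (deg P i <= D) <= _); last first.
  apply: leq_trans (leq_mul cZ (leqnn D)); rewrite -sum_nat_const.
  by apply: leq_sum => i _; case: (leqP (deg P i) D) => dD; rewrite ?muln1 ?muln0.
apply: leq_trans (_ : \sum_(i in Z) \sum_(j in nbrs P i | deg P i <= D) 1 <= _); last first.
  apply: leq_sum => i _; case: (deg P i <= D); last by rewrite big1 // => j /andP[].
  by rewrite muln1 /deg -sum1_card; under eq_bigl do rewrite andbT.
rewrite pair_big_dep /= sum1dep_card; apply/subset_leq_card/subsetP => -[x y] xyM.
rewrite inE /=; apply/andP; split; first by apply/imsetP; exists (x, y).
move: xyM; rewrite !inE /= => /and5P[xyP xy _ _ /andP[-> _]].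
have lxy : x < y by apply: leq_trans xy; rewrite -[X in X < _]addn0 ltn_add2l.
by rewrite /adj /edge lxy xyP andbT -val_eqE /= gtn_eqF.
Qed.

(* The monochromatic edges that are not reversed join close vertices, or
   vertices with few vertices of their class in between, or a vertex of large
   degree; all three kinds are rare in a sparse random graph. *)
Lemma distB_le_dist_BP A L D : 0 < L ->
  D * distB A <= D * (3 * dist_BP (tourn A) + #|short L A|
                      + 2 * ((n %/ L).+1 * (2 * D).+1 * D))
                 + 2 * \sum_v deg A v ^ 2.
Proof.
move=> L0; have [P /existsP[X /andP[tX tcX]] Pd] := dist_BP_ex A.
pose F Y := [set q in P | [&& q.1 + L <= q.2, q.1 \in Y, q.2 \in Y,
      deg P q.1 <= D & deg P q.2 <= D]].
pose H := [set q in A | (q.1 < q.2) && ((D < deg P q.1) || (D < deg P q.2))].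
have mE : #|mono A X| <= #|pdiff A P| + #|short L A| + #|F X| + #|F (~: X)| + #|H|.
  have sub : mono A X \subset
      (((pdiff A P :|: short L A) :|: F X) :|: F (~: X)) :|: H.
    apply/subsetP => q; rewrite !inE => /and3P[qA qlt /eqP qX].
    rewrite qA qlt qX /=; case: (q \in P) => //=.
    by case: leqP; case: leqP; case: leqP; case: (q.2 \in X); rewrite ?orbT.
  apply: leq_trans (subset_leq_card sub) _.
  by do 4 (apply: leq_trans (leq_card_setU _ _) _; rewrite ?leq_add2r).
have := long_edges_le D L0 tX; have := long_edges_le D L0 tcX.
rewrite -/(F X) -/(F (~: X)) => F1 F2.
have := heavy_edges_le A P D; rewrite -/H => H1.
have := distB_le A X; move: mE Pd F1 F2 H1.
set a := #|mono A X|; set b := #|pdiff _ _|; set c := #|short _ _|.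
set d := #|F X|; set e := #|F _|; set h := #|H|; set u := _ * D.
set s := \sum_v _; set t := dist_BP _; set z := distB A => *.
nia.
Qed.

End Comparison.

(** * Arms *)

Section Arms.
Variable n : nat.
Local Notation V := 'I_n.
Local Notation graph := {set V * V}.
Implicit Types (A B I J : graph) (X U : {set V}) (u v w x y : V) (k m : nat).
Local Open Scope nat_scope.

Lemma adj_connect_sym A : connect_sym (adj A).
Proof. by apply: sym_connect_sym => x y; rewrite adjC. Qed.

Lemma adjS A B x y : A \subset B -> adj A x y -> adj B x y.
Proof. by move=> /subsetP; apply. Qed.

Lemma pathS A B x s : A \subset B -> path (adj A) x s -> path (adj B) x s.
Proof. by move=> AB; apply: sub_path => y z; apply: adjS. Qed.

(* If the ends of [q] are not connected, flip the colours of one component. *)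
Lemma distB_add A q : distB (q |: A) <= distB A + connect (adj A) q.1 q.2.
Proof.
have [X XE] := distB_ex A; rewrite {}XE.
have [_|nc] := boolP (connect _ _ _).
  apply: leq_trans (distB_le _ X) _; rewrite addn1 -add1n -(cards1 q).
  apply: leq_trans (leq_card_setU _ _); apply/subset_leq_card/subsetP => e.
  by rewrite !inE => /andP[/orP[->//|->] ->]; rewrite orbT.
rewrite addn0; pose C := [set y | connect (adj A) q.1 y].
pose X' := if (q.1 \in X) == (q.2 \in X) then [set y | (y \in X) (+) (y \in C)] else X.
apply: leq_trans (distB_le _ X') _; apply/subset_leq_card/subsetP => e.
rewrite !inE => /and3P[/predU1P[->|eA] elt].
  rewrite /X'; case: ifP => [/eqP E|-> //]; rewrite !inE E connect0 (negbTE nc).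
  by case: (_ \in X).
rewrite eA elt /= /X'; case: ifP => // _; rewrite !inE.
have -> : connect (adj A) q.1 e.1 = connect (adj A) q.1 e.2.
  by apply: same_connect_r; [apply: adj_connect_sym|apply: connect1; rewrite /adj pair_edge].
by case: (connect _ _ _); case: (_ \in X); case: (_ \in X).
Qed.

(** The set [U] is to be avoided; with [U = [set v]] the event ignores the edges at [v]. *)
Definition arm A k U x := [exists t : k.-tuple V,
  [&& path (adj A) x t, uniq (x :: t) & all [predC U] (x :: t)]].

(** Simple paths make a union bound over edge sets of known size possible; [nearP] shows that
    arbitrary walks give the same relation. *)
Definition near A m x y := [exists j : 'I_m.+1, exists t : j.-tuple V,
  [&& path (adj A) x t, uniq (x :: t) & last x t == y]].

Lemma all_notin0 (s : seq V) : all [predC (set0 : {set V})] s.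
Proof. by apply/allP => y _; rewrite !inE. Qed.

Lemma armP A k U x : reflect (exists s, [/\ size s = k, path (adj A) x s,
  uniq (x :: s) & all [predC U] (x :: s)]) (arm A k U x).
Proof.
apply: (iffP existsP) => [[t /and3P[*]]|[s [<- *]]].
  by exists t; split=> //; rewrite size_tuple.
by exists (in_tuple s); apply/and3P.
Qed.

Lemma nearP A m x y : reflect (exists s, [/\ size s <= m, path (adj A) x s &
  last x s = y]) (near A m x y).
Proof.
apply: (iffP existsP) => [[j /existsP[t /and3P[ps us /eqP ls]]]|[s [sm ps <-]]].
  by exists t; split=> //; rewrite size_tuple -ltnS.
case: (shortenP ps) => s' ps' us' ss'.
have s'm : size s' < m.+1.
  by rewrite ltnS; apply: leq_trans sm; apply: uniq_leq_size ss'; case/andP: us'.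
exists (Ordinal s'm); apply/existsP; exists (in_tuple s').
by apply/and3P.
Qed.

Lemma near_sym A m x y : near A m x y -> near A m y x.
Proof.
case/nearP => s [sm ps <-]; apply/nearP; exists (rev (belast x s)).
rewrite size_rev size_belast rev_path; split=> //.
  by rewrite (eq_path (e' := adj A)) // => a b; rewrite adjC.
by case: s {sm ps} => //= a s; rewrite rev_cons last_rcons.
Qed.

Lemma nearW A k m x y : k <= m -> near A k x y -> near A m x y.
Proof.
by move=> km /nearP[s [sk ps ls]]; apply/nearP; exists s; split=> //; apply: leq_trans km.
Qed.

Lemma near_trans A k m x y z : near A k x y -> near A m y z -> near A (k + m) x z.
Proof.
move=> /nearP[s [sk ps <-]] /nearP[t [tm pt <-]]; apply/nearP; exists (s ++ t).
by rewrite size_cat leq_add // cat_path ps pt last_cat.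
Qed.

Lemma path_near A x s y : path (adj A) x s -> y \in x :: s -> near A (size s) x y.
Proof.
move=> ps; rewrite inE => /predU1P[->|ys].
  by apply/nearP; exists [::].
case/splitPr: ys ps => s1 s2; rewrite -cat_rcons cat_path => /andP[ps1 _].
apply/nearP; exists (rcons s1 y); rewrite ps1 last_rcons; split=> //.
by rewrite size_cat leq_addr.
Qed.

Lemma arm_incr k U x : monotone_pred (fun A => arm A k U x).
Proof.
move=> A B AB /armP[s [sk ps us as_]]; apply/armP; exists s; split=> //.
exact: pathS ps.
Qed.

Lemma connect_incr x y : monotone_pred (fun A => connect (adj A) x y).
Proof.
move=> A B AB /connectP[s ps ->]; apply/connectP; exists s => //.
exact: pathS ps.
Qed.

Lemma arm0 A x : arm A 0 set0 x.
Proof. by apply/armP; exists [::]; rewrite /= inE. Qed.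

Lemma armS A k v : arm A k.+1 set0 v =
  [exists w, [&& w != v, adj A v w & arm A k [set v] w]].
Proof.
apply/armP/existsP => [[[|w s] [] //= [sk] /andP[vw ps] /and3P[vs ws us] _]|].
  exists w; move: (vs); rewrite inE negb_or eq_sym => /andP[-> _].
  rewrite vw; apply/armP; exists s; split=> //=; first by rewrite ws us.
  apply/(allP (s := w :: s)) => y ys; rewrite !inE; apply: contraNneq vs => <-.
  exact: ys.
case=> w /and3P[wv vw /armP[s [<- ps us /allP as_]]].
exists (w :: s); split; [by []|by rewrite /= vw| |exact: all_notin0].
rewrite cons_uniq us andbT; apply/negP => vs.
by have := as_ _ vs; rewrite !inE eqxx.
Qed.

Lemma arm_avoid A k v w : arm A k set0 w -> arm A k [set v] w || near A k w v.
Proof.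
case/armP => s [sk ps us _]; have [vs|vs] := boolP (v \in w :: s); apply/orP.
  by right; rewrite -sk; apply: path_near.
left; apply/armP; exists s; split=> //; apply/allP => y ys.
by rewrite !inE; apply: contraNneq vs => <-.
Qed.

(** A simple path from [u] with more than [k] edges begins with an arm of length [k]. *)
Lemma connect_arm A k u v : connect (adj A) u v -> near A k u v || arm A k set0 u.
Proof.
case/connectP => s0 /shortenP[s ps us _] lv.
have [sk|ks] := leqP (size s) k; apply/orP; [left|right].
  by apply/nearP; exists s.
apply/armP; exists (take k s); split.
- by rewrite size_takel // ltnW.
- by apply: take_path.
- by have := take_uniq k.+1 us.
- exact: all_notin0.
Qed.

Definition induced A X : graph := [set q in A | (q.1 \in X) && (q.2 \in X)].

Lemma path_induced A X x s : path (adj A) x s -> all (mem X) (x :: s) ->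
  path (adj (induced A X)) x s.
Proof.
elim: s x => //= y s IH x /andP[xy ps] /and3P[xX yX sX].
rewrite IH //= ?yX // andbT /adj inE [_ \in A]xy /=.
by rewrite /edge; case: ifP; rewrite /= xX yX.
Qed.

Lemma arm_induced A k x s : path (adj A) x s -> uniq (x :: s) -> size s = k ->
  arm (induced A [set y in x :: s]) k set0 x.
Proof.
move=> ps us sk; apply/armP; exists s; split=> //; last exact: all_notin0.
apply: path_induced => //; apply/allP => y ys. by rewrite inE in_set.
Qed.

(** Two arms that meet give a walk of length at most [k + k]. If they share no vertex, the subgraphs
    induced on their vertex sets are disjoint witnesses. *)
Lemma arm_box A k u w : arm A k set0 u -> arm A k set0 w ->
  near A (k + k) u w || box (fun B => arm B k set0 u) (fun B => arm B k set0 w) A.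
Proof.
move=> /armP[s [sk ps us _]] /armP[t [tk pt ut _]].
have [/hasP[y yt ys]|nst] := boolP (has (mem (u :: s)) (w :: t)); apply/orP; [left|right].
  apply: near_trans (_ : near A k u y) (near_sym _).
    by rewrite -sk; apply: path_near.
  by rewrite -tk; apply: path_near.
apply/boxP; exists (induced A [set y in u :: s]), (induced A [set y in w :: t]).
split; try exact: arm_induced.
- by apply/subsetP => q; rewrite inE => /andP[].
- by apply/subsetP => q; rewrite inE => /andP[].
rewrite -setI_eq0; apply/eqP/setP => q; rewrite !in_setI !in_set.
apply/negbTE; apply: contra nst => /andP[/and3P[_ q1 _] /and3P[_ q1' _]].
by apply/hasP; exists q.1.
Qed.

Definition star v : seq (V * V) := [seq q <- pairs n | (q.1 == v) || (q.2 == v)].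

Lemma arm_star A k v w e : e \in star v -> arm (e |: A) k [set v] w = arm A k [set v] w.
Proof.
move=> ev; apply/armP/armP => -[s [sk ps us as_]]; exists s; split=> //; last first.
  by apply: pathS ps; apply: subsetUr.
elim: s w ps as_ {sk us} => //= y s IH w /andP[wy ps] /and3P[wv yv sv].
rewrite IH //= ?yv // andbT; move: wy; rewrite /adj !inE => /predU1P[E|//].
move: ev; rewrite mem_filter -E /edge; move: wv yv; rewrite !inE.
by case: ifP => _ /= /negbTE -> /negbTE ->.
Qed.

Fixpoint path_edges x s : graph :=
  if s is y :: s' then edge x y |: path_edges y s' else set0.

Lemma path_edgesP A x s : path (adj A) x s = (path_edges x s \subset A).
Proof. by elim: s x => [|y s IH] x /=; rewrite ?sub0set // subUset sub1set IH. Qed.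

Lemma path_edges_sub x s q : q \in path_edges x s -> (q.1 \in x :: s) && (q.2 \in x :: s).
Proof.
elim: s x => [|y s IH] x /=; first by rewrite inE.
rewrite in_setU1 => /predU1P[->|/IH/andP[q1 q2]].
  by rewrite /edge; case: ifP => _ /=; rewrite !inE !eqxx ?orbT.
by rewrite ![_ \in x :: _]inE q1 q2 !orbT.
Qed.

Lemma card_path_edges x s : uniq (x :: s) -> #|path_edges x s| = size s.
Proof.
elim: s x => [|y s IH] x; first by rewrite /= cards0.
move=> us; rewrite [path_edges _ _]/= cardsU1 IH; last by case/andP: us.
rewrite (_ : edge x y \notin _ = true) //; apply/negP => /path_edges_sub.
move: us => /= /andP[xs _]; rewrite /edge.
by case: ifP => _ /=; rewrite (negbTE xs) ?andbF.
Qed.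

Lemma card_tuple_last m x y : #|[set t : m.+1.-tuple V | last x t == y]| <= n ^ m.
Proof.
rewrite -[X in X ^ m]card_ord -card_tuple.
apply: leq_trans (leq_imset_card (fun t : m.-tuple V => [tuple of rcons t y]) _).
apply/subset_leq_card/subsetP => t; rewrite inE => /eqP ty.
have st : size (belast (thead t) (behead t)) == m by rewrite size_belast size_behead size_tuple.
apply/imsetP; exists (Tuple st) => //; apply/val_inj => /=.
by move: ty; rewrite (tuple_eta t) /= => <-; rewrite -lastI.
Qed.

End Arms.

(** * Probabilities of arms, short paths and connections *)

Section ArmProbability.
Variables (R : realType) (n : nat) (p : R).
Hypothesis p2 : 0 <= p <= 1 / 2.
Local Notation V := 'I_n.
Local Notation graph := {set V * V}.
Implicit Types (u v w x y : V) (k m : nat).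

Definition Pr (a : pred graph) : R := Ex p (pairs n) (fun A => (a A)%:R) set0.

Let p01 : 0 <= p <= 1. Proof. by case/andP: p2 => p0 p12; apply/andP; split; lra. Qed.
Let p0 : 0 <= p. Proof. by case/andP: p2. Qed.

Lemma Pr_ge0 (a : pred graph) : 0 <= Pr a.
Proof. by apply: Ex_ge0 => // B; apply: ler0n. Qed.

Lemma Pr_le1 (a : pred graph) : Pr a <= 1.
Proof.
rewrite -[leRHS](Ex_cst p (pairs n) 1 set0); apply: Ex_le => // B.
by rewrite (ler_nat R _ 1) leq_b1.
Qed.

Lemma Pr_le (a b : pred graph) : (forall A, a A -> b A) -> Pr a <= Pr b.
Proof.
by move=> ab; apply: Ex_le => // A; rewrite ler_nat; case: (boolP (a A)) => // /ab ->.
Qed.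

Lemma Pr_leU (a b c : pred graph) : (forall A, a A -> b A || c A) -> Pr a <= Pr b + Pr c.
Proof.
move=> abc; rewrite -ExD; apply: Ex_le => // A; rewrite -natrD ler_nat.
by case: (boolP (a A)) => // /abc /orP[] ->; rewrite // addn1.
Qed.

(** Union bound over simple paths: at most [n ^ j] of them have [j + 1] edges and these ends, each
    is present with probability at most [p ^ (j + 1)], and [n p <= 2]. *)
Lemma Pr_near m x y : x != y -> n%:R * p <= 2 -> 
  Pr (fun A => near A m x y) <= p * (m * 2 ^ m)%:R.
Proof.
move=> xy np; pose a (j : 'I_m.+1) (t : j.-tuple V) := uniq (x :: t) && (last x t == y).
apply: (@le_trans _ _ (\sum_(j < m.+1) \sum_(t : j.-tuple V | a j t)
    Ex p (pairs n) (fun A => (path_edges x t \subset A)%:R) set0)).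
  rewrite /Pr; under eq_bigr do rewrite -Ex_sum; rewrite -Ex_sum; apply: Ex_le => // A.
  case: (boolP (near A m x y)) => [/existsP[j /existsP[t /and3P[ps us ls]]]|_]; last first.
    by apply: sumr_ge0 => j _; apply: sumr_ge0.
  rewrite (bigD1 j) //= (bigD1 t) /=; last by rewrite /a us.
  rewrite -path_edgesP ps -addrA lerDl addr_ge0 //.
    by apply: sumr_ge0.
  by apply: sumr_ge0 => i _; apply: sumr_ge0.
rewrite big_ord_recl big1 ?add0r => [|t]; last first.
  by rewrite /a tuple0 /= (negbTE xy).
apply: (@le_trans _ _ (\sum_(j < m) p * 2 ^+ m)); last first.
  by rewrite sumr_const card_ord -[_ *+ m]mulr_natl natrM natrX mulrCA.
apply: ler_sum => j _.
apply: (@le_trans _ _ (\sum_(t : j.+1.-tuple V | last x t == y) p ^+ j.+1)).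
  rewrite [leRHS]big_mkcond [leLHS]big_mkcond /=; apply: ler_sum => t _.
  rewrite /a; case: eqP => _; rewrite ?andbF //.
  case: ifP => [/andP[us _]|_]; last exact: exprn_ge0.
  apply: le_trans (Ex_subset_le _ _ p01 (pairs_uniq n)) _.
  by rewrite setD0 card_path_edges // size_tuple.
rewrite sumr_const exprS -[leLHS]mulr_natl mulrCA ler_wpM2l //.
apply: (@le_trans _ _ ((n%:R * p) ^+ j)).
  rewrite exprMn -natrX ler_wpM2r ?exprn_ge0 // ler_nat.
  by have := card_tuple_last j x y; rewrite cardsE.
apply: (@le_trans _ _ (2 ^+ j)).
  by rewrite lerXn2r ?nnegrE ?mulr_ge0.
by rewrite ler_weXn2l ?ler1n // ltnW.
Qed.

Lemma Pr_arm2 k u w : u != w -> n%:R * p <= 2 ->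
  Pr (fun A => arm A k set0 u && arm A k set0 w) <=
  p * ((k + k) * 2 ^ (k + k))%:R
  + Pr (fun A => arm A k set0 u) * Pr (fun A => arm A k set0 w).
Proof.
move=> uw np.
apply: (@le_trans _ _ (Pr (fun A => near A (k + k) u w)
  + Pr (box (fun B => arm B k set0 u) (fun B => arm B k set0 w)))).
  by apply: Pr_leU => A /andP[]; apply: arm_box.
by apply: lerD; [exact: Pr_near|apply: BK => //; apply: arm_incr].
Qed.

(** Connected vertices that are not near each other both start an arm, and [Pr_arm2] treats the two
    arms as nearly independent. *)
Lemma Pr_connect k u w : u != w -> n%:R * p <= 2 ->
  Pr (fun A => connect (adj A) u w) <=
  p * (2 * ((k + k) * 2 ^ (k + k)))%:R
  + Pr (fun A => arm A k set0 u) * Pr (fun A => arm A k set0 w).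
Proof.
move=> uw np; rewrite natrM mulrCA mulr_natl mulr2n -addrA.
apply: (@le_trans _ _ (Pr (fun A => near A (k + k) u w)
  + Pr (fun A => arm A k set0 u && arm A k set0 w))); last first.
  by apply: lerD; [exact: Pr_near|exact: Pr_arm2].
apply: Pr_leU => A uwc.
have [|] := boolP (near A (k + k) u w) => //= nuw.
have := connect_arm k uwc; have := connect_arm k (_ : connect (adj A) w u).
rewrite adj_connect_sym uwc => /(_ isT).
have nW x y : near A k x y -> near A (k + k) x y by apply: nearW; rewrite leq_addr.
case/orP => [/nW/near_sym|->]; rewrite ?(negbTE nuw) //.
by case/orP => [/nW|->]; rewrite ?(negbTE nuw).
Qed.

(** The candidates for the second vertex of an arm at [v]; the set is determined by the edges away
    from [v]. *)
Definition conts k v (A : graph) := [set w | (w != v) && arm A k [set v] w].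

(** The graph outside [v] is exposed first. Then [v] starts no arm of length [k + 1] exactly when
    all edges from [v] to [conts k v] are missing. *)
Lemma Pr_armS k v :
  Pr (fun A => arm A k.+1 set0 v) =
  Ex p (pairs n) (fun A => 1 - (1 - p) ^+ #|conts k v A|) set0.
Proof.
pose st := star v; pose rest := [seq q <- pairs n | ~~ ((q.1 == v) || (q.2 == v))].
have pE : perm_eq (pairs n) (rest ++ st).
  by rewrite perm_sym perm_catC perm_filterC.
rewrite /Pr !(Ex_perm _ _ _ pE) !Ex_cat.
(* After the first round no edge at [v] is present. *)
pose I (A : graph) := forall w, w != v -> edge v w \notin A.
apply: (@Ex_eq_inv _ _ _ _ I); last 1 first.
- by move=> w _; rewrite inE.
- move=> e B; rewrite mem_filter => /andP[ev ep] IB w wv.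
  rewrite !inE negb_or IB // andbT; apply: contra ev => /eqP <-.
  by rewrite /edge; case: ifP => _ /=; rewrite eqxx ?orbT.
move=> B IB; rewrite [RHS]Ex_indep; last first.
  move=> e C es; congr (1 - _ ^+ _); apply: eq_card => w.
  by rewrite !inE arm_star.
(* An arm at [v] exists exactly when the second round draws an edge of [G]. *)
pose G := [set edge v w | w in conts k v B].
transitivity (Ex p st (fun C => 1 + -1 * (C :&: G == set0)%:R) B).
  pose I' (C : graph) := conts k v C = conts k v B.
  apply: (@Ex_eq_inv _ _ _ _ I') => // [e C es IC|C IC].
    by rewrite /I' -IC; apply/setP => w; rewrite !inE arm_star.
  rewrite armS; set x := [exists w, _]; suff -> : (C :&: G == set0) = ~~ x.
    by case: x; rewrite /=; lra.
  apply/eqP/existsPn => [CG w|H].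
    apply/negP => /and3P[wv vw aw].
    have : edge v w \in C :&: G.
      rewrite inE [_ \in C]vw; apply/imsetP; exists w => //.
      by rewrite -IC inE wv.
    by rewrite CG inE.
  apply/setP => q; rewrite !inE; apply/negbTE/negP => /andP[qC /imsetP[w]].
  rewrite -IC inE => /andP[wv aw] qE; have := H w.
  by rewrite wv aw /adj -qE qC.
rewrite ExD ExZ Ex_cst Ex_avoid.
have -> : B :&: G = set0.
  apply/setP => q; rewrite !inE; apply/negbTE/negP => /andP[qB /imsetP[w]].
  by rewrite inE => /andP[/IB + _] qE; rewrite -qE qB.
rewrite eqxx mul1r mulN1r; congr (1 - _ ^+ _).
have Guniq : {in conts k v B &, injective (edge v)}.
  by move=> w w' _ _ /edge_inj[[_ ->]|[<- ->]].
rewrite -(card_in_imset Guniq) -size_filter -/G.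
rewrite -[LHS](card_uniqP _); last by do 2 apply: filter_uniq; exact: pairs_uniq.
apply: eq_card => q; rewrite mem_filter /=; apply/andP/idP => [[]//|qG].
split=> //; case/imsetP: qG => w; rewrite inE => /andP[wv _] ->.
rewrite mem_filter edge_mem_pairs 1?eq_sym // andbT.
by rewrite /edge; case: ifP => _ /=; rewrite eqxx ?orbT.
Qed.

End ArmProbability.

(** * The probability of a long arm *)

(** The second-order binomial term enters with half its weight, which keeps this a lower bound as
    long as [p w <= 2]. *)
Lemma expr1B_ge (R : realType) (p : R) (w : nat) : 0 <= p <= 1 -> p * w%:R <= 2 ->
  1 - p * w%:R + p ^+ 2 * w%:R ^+ 2 / 4 - p ^+ 2 * w%:R / 4 <= (1 - p) ^+ w.
Proof.
move=> /andP[p0 p1]; elim: w => [|w IH]; first by rewrite expr0 !mulr0; lra.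
rewrite -natr1 [(1 - p) ^+ _]exprS => pw; set x := w%:R in IH pw *.
have x0 : 0 <= x by apply: ler0n.
have {}IH : 1 - p * x + p ^+ 2 * x ^+ 2 / 4 - p ^+ 2 * x / 4 <= (1 - p) ^+ w.
  by apply: IH; lra.
have p1' : 0 <= 1 - p by lra.
apply: le_trans _ (ler_wpM2l p1' IH).
have : 0 <= p ^+ 2 * x * (2 - p * x) by rewrite !mulr_ge0 ?sqr_ge0 //; lra.
have : 0 <= p ^+ 3 * x by rewrite mulr_ge0 // exprn_ge0.
nra.
Qed.

Lemma expr1B_le (R : realType) (p : R) (w : nat) : 0 <= p <= 1 ->
  (1 - p) ^+ w <= 1 - p * w%:R + p ^+ 2 * w%:R ^+ 2 / 2.
Proof.
(* The induction needs the exact second-order truncation, with [w ^ 2 - w]. *)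
move=> /andP[p0 p1]; suff : (1 - p) ^+ w <= 1 - p * w%:R + p ^+ 2 * (w%:R ^+ 2 - w%:R) / 2.
  have : 0 <= p ^+ 2 * w%:R :> R by rewrite mulr_ge0 ?sqr_ge0.
  lra.
elim: w => [|w IH]; first by rewrite expr0 !mulr0; lra.
rewrite -natr1 [(1 - p) ^+ _]exprS; have p1' : 0 <= 1 - p by lra.
apply: le_trans (ler_wpM2l p1' IH) _.
have x2 : 0 <= w%:R ^+ 2 - w%:R :> R.
  by rewrite subr_ge0 -natrX ler_nat; case: w {IH} => // w; rewrite expnS expn1 leq_pmulr.
set x := w%:R in x2 *; have : 0 <= p ^+ 3 * (x ^+ 2 - x) by rewrite mulr_ge0 // exprn_ge0.
rewrite !expr2 !exprS; lra.
Qed.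

Section Recursion.
Variables (R : realType) (n : nat) (p : R).
Hypothesis p2 : 0 <= p <= 1 / 2.
Hypothesis np : n%:R * p <= 2.
Local Notation V := 'I_n.
Local Notation graph := {set V * V}.
Implicit Types (u v w x y : V) (k m : nat).

Let p01 : 0 <= p <= 1. Proof. by case/andP: p2 => p0 p12; apply/andP; split; lra. Qed.
Let p0 : 0 <= p. Proof. by case/andP: p2. Qed.

Lemma natr_card_set (P : pred V) : (#|[set w | P w]|)%:R = \sum_w (P w)%:R :> R.
Proof. by rewrite -sum1dep_card natr_sum [LHS]big_mkcond; apply: eq_bigr => w _; case: (P w). Qed.

Lemma Ex_conts k v : Ex p (pairs n) (fun A => (#|conts k v A|)%:R) set0 =
  \sum_w Pr p (fun A => (w != v) && arm A k [set v] w).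
Proof. by rewrite -Ex_sum; apply: eq_Ex => A; rewrite natr_card_set. Qed.

Lemma arm_sub A k U w : arm A k U w -> arm A k set0 w.
Proof.
by case/armP => s [sk ps us _]; apply/armP; exists s; split=> //; apply: all_notin0.
Qed.

(* [1 - (1 - p) ^ w] is bounded by [x - x ^ 2 / 4 + p x / 4] at [x = p w], and
   Jensen's inequality replaces [w] by its mean. *)
Lemma arm_upper_step k (b : R) : 0 <= b <= 1 ->
  (forall v, Pr p (fun A => arm A k set0 v) <= b) ->
  forall v, Pr p (fun A => arm A k.+1 set0 v) <=
    n%:R * p * b - (n%:R * p * b) ^+ 2 / 4 + p * (n%:R * p * b) / 4.
Proof.
move=> /andP[b0 b1] Hb v; rewrite Pr_armS //.
pose W A : R := (#|conts k v A|)%:R.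
set m := Ex p (pairs n) W set0.
have mb : m <= n%:R * b.
  rewrite /m /W Ex_conts -[n in n%:R]card_ord mulr_natl -sumr_const.
  by apply: ler_sum => w _; apply: le_trans (Hb w); apply: (Pr_le p2) => A /andP[_ /arm_sub].
have m0 : 0 <= m by apply: Ex_ge0 => // A; apply: ler0n.
apply: (@le_trans _ _ (p * m - p ^+ 2 / 4 * m ^+ 2 + p ^+ 2 / 4 * m)).
  apply: (@le_trans _ _ (Ex p (pairs n) (fun A => p * W A +
    (- (p ^+ 2 / 4) * W A ^+ 2 + p ^+ 2 / 4 * W A)) set0)).
    apply: Ex_le => // A.
    have := @expr1B_ge _ p #|conts k v A| p01.
    rewrite -/(W A) => H; suff : p * W A <= 2 by move=> /H; lra.
    rewrite mulrC; apply: le_trans np; apply: ler_wpM2r => //.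
    by rewrite ler_nat -[X in (_ <= X)%N]card_ord max_card.
  rewrite !ExD !ExZ -/m; have := Ex_jensen (pairs n) W set0 p01; rewrite -/m => J.
  have := ler_wpM2l (_ : 0 <= p ^+ 2 / 4) J.
  by rewrite divr_ge0 ?sqr_ge0 // => /(_ isT); lra.
have npb : n%:R * p * b <= 2 by apply: le_trans np; rewrite ler_piMr // mulr_ge0.
set z := n%:R * p * b in npb *; have pm : p * m <= z.
  by rewrite /z (mulrC _ p) -mulrA ler_wpM2l.
have pm0 : 0 <= p * m by rewrite mulr_ge0.
have p0' : 0 <= p := p0.
(* The bound [x - x ^ 2 / 4 + p x / 4] increases on [[0, 2]]: this product is four times its
   increment from [p * m] to [z]. *)
have : 0 <= (z - p * m) * (4 - z - p * m + p) by rewrite mulr_ge0 //; lra.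
by rewrite !expr2; lra.
Qed.

(** Second moment: [1 - (1 - p) ^ w >= p w - (p w) ^ 2 / 2]. The mean of [w] loses only arms that
    run through [v], by [Pr_near], and its second moment is close to the square [s ^+ 2] by
    [Pr_arm2]. *)
Lemma arm_lower_step k v (C := ((k + k) * 2 ^ (k + k))%:R : R)
    (y := p * \sum_(w < n) Pr p (fun A => arm A k set0 w)) :
  y - y ^+ 2 / 2 - 2 * p * (1 + 2 * C) <= Pr p (fun A => arm A k.+1 set0 v).
Proof.
rewrite Pr_armS //; pose W A : R := (#|conts k v A|)%:R.
set s := \sum_w _ in y *; set m := Ex p (pairs n) W set0.
have C0 : 0 <= C by apply: ler0n.
have ms : s - 1 - 2 * C <= m.
  rewrite /m /W Ex_conts (bigD1 v) //= /s (bigD1 v) //=.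
  have := Pr_le1 p2 (fun A => arm A k set0 v).
  have := Pr_ge0 p2 (fun A => (v != v) && arm A k [set v] v).
  suff : \sum_(w | w != v) Pr p (fun A => arm A k set0 w) - 2 * C <=
    \sum_(w | w != v) Pr p (fun A => (w != v) && arm A k [set v] w) by lra.
  rewrite lerBlDr; apply: (@le_trans _ _ (\sum_(w | w != v)
      (Pr p (fun A => (w != v) && arm A k [set v] w) + p * C))).
    apply: ler_sum => w wv; apply: (@le_trans _ _
      (Pr p (fun A => (w != v) && arm A k [set v] w) + Pr p (fun A => near A k w v))).
      by apply: (Pr_leU p2) => A; rewrite wv; apply: arm_avoid.
    rewrite lerD2l; apply: le_trans (Pr_near p2 k wv np) _.
    rewrite ler_wpM2l // ler_nat leq_mul ?leq_addr // leq_exp2l // leq_addr //.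
  rewrite big_split lerD2l /= sumr_const.
  rewrite -[leLHS]mulr_natl mulrA; apply: ler_wpM2r => //; apply: le_trans np.
  by apply: ler_wpM2r => //; rewrite ler_nat -[X in (_ <= X)%N]card_ord max_card.
have m2 : Ex p (pairs n) (fun A => W A ^+ 2) set0 <= s ^+ 2 + n%:R * (1 + 2 * C).
  have -> : Ex p (pairs n) (fun A => W A ^+ 2) set0 =
    \sum_w \sum_x Pr p (fun A => (w \in conts k v A) && (x \in conts k v A)).
    under eq_bigr do rewrite -Ex_sum; rewrite -Ex_sum; apply: eq_Ex => A.
    rewrite /W expr2 natr_card_set big_distrl /=; apply: eq_bigr => w _.
    rewrite big_distrr /=; apply: eq_bigr => x _; rewrite !inE.
    by rewrite -natrM mulnb.
  apply: (@le_trans _ _ (\sum_w \sum_x (Pr p (fun A => arm A k set0 w) *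
    Pr p (fun A => arm A k set0 x) + ((w == x)%:R + p * C)))).
    apply: ler_sum => w _; apply: ler_sum => x _; have [->|wx] := eqVneq w x.
      rewrite -[leLHS]add0r lerD ?mulr_ge0 ?Pr_ge0 //.
      by apply: le_trans (Pr_le1 p2 _) _; rewrite lerDl mulr_ge0.
    rewrite add0r addrC; apply: le_trans (Pr_arm2 p2 k wx np).
    apply: (Pr_le p2) => A; rewrite !inE => /andP[/andP[_ /arm_sub ->] /andP[_]].
    exact: arm_sub.
  rewrite -subr_ge0; under eq_bigr do rewrite big_split big_split /=.
  rewrite big_split big_split /=.
  have -> : \sum_(i < n) \sum_(i0 < n)
      Pr p (fun A => arm A k set0 i) * Pr p (fun A => arm A k set0 i0) = s ^+ 2.
    by rewrite expr2 /s big_distrl /=; apply: eq_bigr => w _; rewrite big_distrr.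
  have -> : \sum_(i < n) \sum_i0 (i == i0)%:R = n%:R :> R.
    rewrite -[in RHS](card_ord n) -sumr_const; apply: eq_bigr => w _.
    rewrite (bigD1 w) //= eqxx big1 ?addr0 // => x xw.
    by rewrite eq_sym (negbTE xw).
  have -> : \sum_(i < n) \sum_(j < n) p * C = n%:R * (n%:R * (p * C)).
    by rewrite !sumr_const card_ord !mulr_natl.
  have : 0 <= n%:R * C * (2 - n%:R * p) by rewrite !mulr_ge0 ?subr_ge0.
  lra.
apply: (@le_trans _ _ (p * m - p ^+ 2 / 2 * (s ^+ 2 + n%:R * (1 + 2 * C)))).
  have := ler_wpM2l p0 ms.
  have : 0 <= p * (1 + 2 * C) * (2 - n%:R * p).
    by rewrite !mulr_ge0 ?subr_ge0 //; lra.
  rewrite /y exprMn; nra.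
apply: (@le_trans _ _ (Ex p (pairs n) (fun A => p * W A + (- (p ^+ 2 / 2)) * W A ^+ 2) set0)).
  rewrite ExD !ExZ -/m; have := ler_wpM2l (_ : 0 <= p ^+ 2 / 2) m2.
  by rewrite divr_ge0 ?sqr_ge0 // => /(_ isT); lra.
by apply: Ex_le => // A; have := expr1B_le #|conts k v A| p01; rewrite -/(W A); lra.
Qed.

End Recursion.

Lemma natr_gt_ex (R : realType) (x : R) :
  exists N : nat, forall n, (N <= n)%N -> x < n%:R.
Proof.
exists (Num.bound `|x|) => n Nn; apply: le_lt_trans (ler_norm x) _.
by apply: lt_le_trans (archi_boundP (normr_ge0 x)) _; rewrite ler_nat.
Qed.

(* As long as the bound [b] on the probability of a [k]-arm exceeds
   [4 (n p - 1) + eta], one step decreases it by [eta ^ 2 / 8]. *)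
Lemma arm_upper (R : realType) (eta : R) : 0 < eta ->
  exists K n0 : nat, forall (n : nat) (p : R), (n0 <= n)%N -> 1 <= n%:R * p <= 2 ->
    forall v : 'I_n, Pr p (fun A => arm A K set0 v) <= 4 * (n%:R * p - 1) + eta.
Proof.
move=> eta0; pose d := eta ^+ 2 / 8; have d0 : 0 < d by rewrite divr_gt0 ?exprn_gt0.
have [K HK] := natr_gt_ex (1 / d).
(* [K] is used twice: [K] steps of size [d] exhaust the interval [[0, 1]], and [n >= K] forces
   [1 / n <= d]. *)
exists K, (maxn K 4) => n p; rewrite geq_max => /andP[Kn nn] /andP[np1 np2].
have dn : 1 / n%:R <= d.
  have n0 : 0 < n%:R :> R by rewrite ltr0n; apply: leq_trans nn.
  by rewrite ler_pdivrMr // mulrC -ler_pdivrMr // ltW // HK.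
have n4 : 4 <= n%:R :> R by rewrite (ler_nat R 4).
have p2n : 2 * (1 / n%:R) >= p by rewrite mulrA mulr1 ler_pdivlMr 1?mulrC //; lra.
have p0 : 0 <= p by rewrite -(@pmulr_rge0 _ n%:R); lra.
have p2 : 0 <= p <= 1 / 2 by rewrite p0; nra.
set g := 4 * (n%:R * p - 1) + eta; have [g1|g1] := leP 1 g.
  by move=> v; apply: le_trans g1; apply: Pr_le1.
have g0 : eta <= g by rewrite /g; lra.
suff H k : forall v : 'I_n, Pr p (fun A => arm A k set0 v) <= Num.max (1 - k%:R * d) g.
  move=> v; apply: le_trans (H _ v) _; rewrite ge_max lexx andbT.
  by have := HK K (leqnn K); rewrite ltr_pdivrMr // => /ltW; lra.
elim: k => [|k IH] v; first by rewrite mul0r subr0 le_max Pr_le1.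
set b := Num.max _ g in IH; have b1 : b <= 1.
  by rewrite ge_max (ltW g1) andbT lerBlDr lerDl mulr_ge0 // ltW.
have gb : g <= b by rewrite le_max lexx orbT.
have b0 : 0 <= b <= 1 by rewrite b1 andbT; lra.
apply: (@le_trans _ _ (b - d)); last first.
  rewrite /b lerBlDr ge_max; apply/andP; split.
    by rewrite -lerBlDr le_max -natr1; apply/orP; left; lra.
  by rewrite -lerBlDr le_max; apply/orP; right; lra.
apply: le_trans (arm_upper_step p2 np2 b0 IH v) _.
rewrite -/g in gb; move: gb; rewrite /g; set c := n%:R * p in np1 np2 * => gb.
have : p * (c * b) / 4 <= d.
  have cb : c * b <= 2 by nra.
  have cb0 : 0 <= c * b by nra.
  nra.
have : b ^+ 2 <= (c * b) ^+ 2 by rewrite lerXn2r ?nnegrE //; nra.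
(* From [b >= 4 * (c - 1) + eta] and [b >= eta] the quadratic term wins by [eta ^ 2 / 4 = 2 * d];
   one [d] pays for the error [p * (c * b) / 4], the other is the decrease. *)
have : c * b + 2 * d <= b + b ^+ 2 / 4.
  rewrite /d !expr2.
  have : 0 <= b * (b - 4 * (c - 1) - eta) by rewrite mulr_ge0 //; lra.
  have : 0 <= eta * (b - eta) by rewrite mulr_ge0 //; lra.
  lra.
lra.
Qed.

(** Induction on [k]: the bound [e / 2] is first multiplied by [1 + e], and the gain [e ^ 2 / 2]
    outweighs both the quadratic loss and, for [n] large in terms of [k], the error term. *)
Lemma arm_lower (R : realType) (e : R) (k : nat) : 0 < e -> e <= 1 / 2 ->
  exists n0 : nat, forall (n : nat) (p : R), (n0 <= n)%N -> n%:R * p = 1 + e ->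
    forall v : 'I_n, e / 2 <= Pr p (fun A => arm A k set0 v).
Proof.
move=> e0 e2; elim: k => [|k [n1 IH]].
  exists 0%N => n p _ _ v; rewrite /Pr.
  rewrite (@eq_Ex _ _ _ _ _ (fun=> 1)) ?Ex_cst; last by move=> A; rewrite arm0.
  lra.
pose C := ((k + k) * 2 ^ (k + k))%:R : R; have C0 : 0 <= C by apply: ler0n.
have [M HM] := natr_gt_ex (32 * (1 + 2 * C) / e ^+ 2).
exists (maxn n1 (maxn M 4)) => n p; rewrite !geq_max => /and3P[nn1 /HM {}HM n4] npE v.
have {}n4 : 4 <= n%:R :> R by rewrite (ler_nat R 4).
have n0 : 0 < n%:R :> R by lra.
have pE : p = (1 + e) / n%:R by rewrite -npE mulrAC divff ?mul1r // gt_eqF.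
have p0 : 0 <= p by rewrite pE divr_ge0 //; lra.
have p2 : 0 <= p <= 1 / 2 by rewrite p0 /= pE ler_pdivrMr //; lra.
have np2 : n%:R * p <= 2 by lra.
have := arm_lower_step p2 np2 k v; rewrite -/C.
set y := p * _ => H; apply: le_trans H.
have y1 : (1 + e) * (e / 2) <= y.
  rewrite /y -npE [n%:R * p]mulrC -mulrA ler_wpM2l //.
  rewrite -[n in n%:R]card_ord mulr_natl -sumr_const; apply: ler_sum => w _.
  exact: IH.
have y2 : y <= 1 + e.
  rewrite /y -npE [n%:R * p]mulrC ler_wpM2l //.
  rewrite -[n in n%:R]card_ord -sumr_const; apply: ler_sum => w _.
  exact: Pr_le1.
have err : 2 * p * (1 + 2 * C) <= e ^+ 2 / 8.
  move/ltW: HM; rewrite ler_pdivrMr ?exprn_gt0 // => HM.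
  rewrite -(ler_pM2l n0).
  have -> : n%:R * (2 * p * (1 + 2 * C)) = 2 * (n%:R * p) * (1 + 2 * C) by ring.
  rewrite npE; nra.
(* By concavity [y - y ^ 2 / 2] lies above its chord between the two bounds on [y]; this product
   expresses it. *)
have : 0 <= (y - (1 + e) * (e / 2)) * (1 + e - y) by rewrite mulr_ge0 // subr_ge0.
move: y1 y2 err; rewrite !expr2 => y1 y2 err Hy.
have : (y - (1 + e) * (e / 2)) * (1 + e) * (1 - (1 + e) / 2 - e / 4) >= 0.
  rewrite !mulr_ge0 //; lra.
nra.
Qed.

(** * Upper bound *)

(* Kruskal: an edge that closes no cycle when it is added costs nothing. *)
Lemma Ex_distB_le (R : realType) (n : nat) (p : R) (es : seq ('I_n * 'I_n)) A :
  0 <= p <= 1 ->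
  Ex p es (fun B => (distB B)%:R) A <= (distB A)%:R +
    p * \sum_(e <- es) Ex p es (fun B => (connect (adj B) e.1 e.2)%:R) A.
Proof.
move=> p01; have /andP[p0 p1] := p01.
have ci e : forall C D : {set 'I_n * 'I_n}, C \subset D ->
    (connect (adj C) e.1 e.2)%:R <= (connect (adj D) e.1 e.2)%:R :> R.
  move=> C D CD; rewrite ler_nat.
  by case: (boolP (connect (adj C) _ _)) => // /(connect_incr CD) ->.
elim: es => [|e es IH]; first by rewrite big_nil mulr0 addr0.
apply: (@le_trans _ _ (Ex p es (fun B => (distB B)%:R) A +
   p * Ex p es (fun B => (connect (adj B) e.1 e.2)%:R) A)).
  rewrite /= Ex_shift1.
  have : Ex p es (fun C => (distB (e |: C))%:R) A <=
    Ex p es (fun B => (distB B)%:R) A + Ex p es (fun B => (connect (adj B) e.1 e.2)%:R) A.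
    by rewrite -ExD; apply: Ex_le => // B; rewrite -natrD ler_nat distB_add.
  by move=> /(ler_wpM2l p0); lra.
have H (e' : 'I_n * 'I_n) : Ex p es (fun B => (connect (adj B) e'.1 e'.2)%:R) A <=
   Ex p (e :: es) (fun B => (connect (adj B) e'.1 e'.2)%:R) A.
  by apply: Ex_cons_incr => //; apply: ci.
rewrite big_cons; have := ler_wpM2l p0 (H e).
have : \sum_(e' <- es) Ex p es (fun B => (connect (adj B) e'.1 e'.2)%:R) A <=
   \sum_(e' <- es) Ex p (e :: es) (fun B => (connect (adj B) e'.1 e'.2)%:R) A.
  by apply: ler_sum => e' _; apply: H.
by move=> /(ler_wpM2l p0); move: IH; lra.
Qed.

Lemma size_pairs n : (size (pairs n) <= n * n)%N.
Proof.
by rewrite size_filter; apply: leq_trans (count_size _ _) _; rewrite -cardE card_prod card_ord.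
Qed.

Lemma sum_connect_le (R : realType) (n : nat) (p b : R) k :
  0 <= p <= 1 / 2 -> n%:R * p <= 2 -> 
  (forall v : 'I_n, Pr p (fun A => arm A k set0 v) <= b) ->
  \sum_(e <- pairs n) Ex p (pairs n) (fun B => (connect (adj B) e.1 e.2)%:R) set0 <=
  n%:R ^+ 2 * (p * (2 * ((k + k) * 2 ^ (k + k)))%:R + b ^+ 2).
Proof.
move=> p2 np Hb; have p0 : 0 <= p by case/andP: p2.
apply: (@le_trans _ _ (\sum_(e <- pairs n) (p * (2 * ((k + k) * 2 ^ (k + k)))%:R + b ^+ 2))).
  rewrite big_seq [leRHS]big_seq; apply: ler_sum => e.
  rewrite mem_pairs => elt; have e12 : e.1 != e.2 by rewrite -val_eqE /= ltn_eqF.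
  apply: le_trans (Pr_connect p2 k e12 np) _; rewrite lerD2l expr2.
  by apply: ler_pM => //; apply: Pr_ge0.
rewrite big_const_seq count_predT iter_addr_0 -[leLHS]mulr_natl -natrX.
rewrite ler_wpM2r ?addr_ge0 ?sqr_ge0 ?mulr_ge0 // ler_nat.
by rewrite expnS expn1 size_pairs.
Qed.

(** Two rounds. At [1 / n] arms have probability at most [eps ^ 2], so the first round costs about
    [eps ^ 4 n]. In the final graph arms have probability at most [5 * eps], so the second round
    costs about [2 * eps * 25 * eps ^ 2 * n]. The terms in [C] are absorbed for large [n]. *)
Lemma expected_distB_upper (R : realType) (eps : R) : 0 < eps -> eps < 1 ->
  exists n0 : nat, forall n, (n0 <= n)%N ->
    Ex ((1 + eps) / n%:R) (pairs n) (fun A => (distB A)%:R) set0 <= 60 * eps ^+ 3 * n%:R.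
Proof.
move=> e0 e1; have [K [n1 HK]] := arm_upper (exprn_gt0 2 e0).
pose C := (2 * ((K + K) * 2 ^ (K + K)))%:R : R; have C0 : 0 <= C by apply: ler0n.
have e3 : 0 < eps ^+ 3 by rewrite exprn_gt0.
have [n2 Hn2] := natr_gt_ex (C / eps ^+ 3).
exists (maxn n1 (maxn n2 4)) => n; rewrite !geq_max => /and3P[nn1 /Hn2 {}Hn2 n4].
have {}n4 : 4 <= n%:R :> R by rewrite (ler_nat R 4).
have {}Hn2 : C <= eps ^+ 3 * n%:R by rewrite mulrC -ler_pdivrMr // ltW.
have n0 : 0 < n%:R :> R by lra.
have nV : n%:R * n%:R^-1 = 1 :> R by rewrite divff // gt_eqF.
(* The denominator [n - 1] makes [1 - p = (1 - p1) * (1 - q)] exact. *)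
set p := (1 + eps) / n%:R; pose p1 : R := 1 / n%:R; pose q : R := eps / (n%:R - 1).
have npE : n%:R * p = 1 + eps by rewrite /p mulrCA nV mulr1.
have np1E : n%:R * p1 = 1 by rewrite /p1 mul1r.
have p2 : 0 <= p <= 1 / 2.
  by rewrite /p divr_ge0 ?ler_pdivrMr //; lra.
have p12 : 0 <= p1 <= 1 / 2 by rewrite /p1 divr_ge0 ?ler_pdivrMr //; lra.
have q01 : 0 <= q <= 1 by rewrite /q divr_ge0 ?ler_pdivrMr //; lra.
have q2 : q * n%:R <= 2 * eps by rewrite /q mulrAC ler_pdivrMr; nra.
have spr : 1 - p = (1 - p1) * (1 - q).
  by rewrite /p /p1 /q; field; rewrite !gt_eqF //; lra.
have to1 (r : R) : 0 <= r <= 1 / 2 -> 0 <= r <= 1.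
  by move=> /andP[r0 r2]; apply/andP; split; lra.
rewrite (Ex_sprinkle _ _ _ spr).
apply: (@le_trans _ _ (Ex p1 (pairs n) (fun A => (distB A)%:R +
   q * \sum_(e <- pairs n) Ex q (pairs n) (fun B => (connect (adj B) e.1 e.2)%:R) A) set0)).
  by apply: Ex_le => [|B]; [exact: to1|exact: Ex_distB_le].
rewrite ExD ExZ Ex_sum.
under eq_bigr do rewrite -(Ex_sprinkle _ _ _ spr).
have D1 := Ex_distB_le (pairs n) set0 (to1 _ p12).
have d0 : distB (set0 : {set 'I_n * 'I_n}) = 0%N.
  apply/eqP; rewrite -leqn0; apply: leq_trans (distB_le _ set0) _.
  rewrite leqn0 cards_eq0; apply/eqP/setP => x; by rewrite !inE.
rewrite d0 add0r in D1.
have S1 : \sum_(e <- pairs n) Ex p1 (pairs n) (fun B => (connect (adj B) e.1 e.2)%:R) set0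
  <= n%:R ^+ 2 * (p1 * C + eps ^+ 4).
  rewrite -[4%N]/(2 * 2)%N exprM; apply: sum_connect_le => //; first lra.
  by move=> v; have := HK n p1 nn1 _ v; rewrite np1E; move=> H; apply: le_trans (H _) _; lra.
have S2 : \sum_(e <- pairs n) Ex p (pairs n) (fun B => (connect (adj B) e.1 e.2)%:R) set0
  <= n%:R ^+ 2 * (p * C + (5 * eps) ^+ 2).
  apply: sum_connect_le => //; first lra.
  move=> v; have := HK n p nn1 _ v; rewrite npE; move=> H; apply: le_trans (H _) _; first lra.
  by rewrite expr2; nra.
have p10 : 0 <= p1 by case/andP: p12.
have q0 : 0 <= q by case/andP: q01.
have := ler_wpM2l p10 S1; have := ler_wpM2l q0 S2.
move: D1; set X := Ex _ _ _ _; set Y := \sum_(e <- _) _; set Z := \sum_(e <- _) _ => D1 T2 T1.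
have E1 : p1 * (n%:R ^+ 2 * (p1 * C + eps ^+ 4)) = C + eps ^+ 4 * n%:R.
  transitivity ((n%:R * p1) ^+ 2 * C + (n%:R * p1) * n%:R * eps ^+ 4); first by ring.
  by rewrite np1E; ring.
have E2 : q * (n%:R ^+ 2 * (p * C + (5 * eps) ^+ 2)) =
   q * n%:R * ((1 + eps) * C + 25 * eps ^+ 2 * n%:R).
  by rewrite -npE; ring.
have B2 : q * n%:R * ((1 + eps) * C + 25 * eps ^+ 2 * n%:R) <=
   2 * eps * ((1 + eps) * C + 25 * eps ^+ 2 * n%:R).
  by apply: ler_wpM2r => //; rewrite addr_ge0 // !mulr_ge0 ?sqr_ge0 //; lra.
have B1 : eps ^+ 4 * n%:R <= eps ^+ 3 * n%:R.
  rewrite ler_wpM2r ?ler0n // exprS -[leRHS]mul1r ler_wpM2r //; lra.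
have B3 : 2 * eps * ((1 + eps) * C) <= 4 * C.
  rewrite mulrA ler_wpM2r //; nra.
have E3 : eps * eps ^+ 2 = eps ^+ 3 by rewrite -exprS.
have : 2 * eps * (25 * eps ^+ 2 * n%:R) = 50 * (eps ^+ 3 * n%:R) by rewrite -E3; ring.
lra.
Qed.

(** * Cutting components into pieces *)

Section Pieces.
Variable n : nat.
Local Notation V := 'I_n.
Local Notation graph := {set V * V}.
Variable A : graph.
Implicit Types (C D Q U X Y : {set V}) (r x y z : V) (s : nat).
Local Open Scope nat_scope.

Definition inner C : rel V := fun x y => [&& adj A x y, x \in C & y \in C].

(** Connected by paths that stay inside [C], which is more than lying in one component. *)
Definition linked C := [forall x in C, forall y in C, connect (inner C) x y].

Lemma connect_invariant (T : finType) (e : rel T) (Z : {set T}) (x y : T) :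
  (forall z z' : T, z \in Z -> e z z' -> z' \in Z) -> connect e x y -> x \in Z -> y \in Z.
Proof.
move=> cl /connectP[p pp ->]; elim: p x pp => //= z p IH x /andP[xz pp] xZ.
by apply: IH pp _; apply: cl xz.
Qed.

Lemma inner_sym C : connect_sym (inner C).
Proof. by apply: sym_connect_sym => x y; rewrite /inner adjC; congr (_ && _); rewrite andbC. Qed.

Lemma innerS C D x y : C \subset D -> connect (inner C) x y -> connect (inner D) x y.
Proof.
move=> /subsetP CD; apply: connect_sub => u v /and3P[uv uC vC].
by apply: connect1; rewrite /inner uv !CD.
Qed.

Lemma linked_root C r : (forall x, x \in C -> connect (inner C) r x) -> linked C.
Proof.
move=> H; apply/forall_inP => x xC; apply/forall_inP => y yC.
by apply: connect_trans (H y yC); rewrite inner_sym H.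
Qed.

Lemma linkedP C x y : linked C -> x \in C -> y \in C -> connect (inner C) x y.
Proof. by move=> /forall_inP/(_ x) H xC yC; move/forall_inP: (H xC); apply. Qed.

Lemma linked1 r : linked [set r].
Proof. by apply: (@linked_root _ r) => x; rewrite inE => /eqP ->. Qed.

Lemma linkedU C D z : linked C -> linked D -> z \in C -> z \in D -> linked (C :|: D).
Proof.
move=> lC lD zC zD; apply: (@linked_root _ z) => x; rewrite inE => /orP[xC|xD].
  by apply: innerS (linkedP lC zC xC); apply: subsetUl.
by apply: innerS (linkedP lD zD xD); apply: subsetUr.
Qed.

Lemma linkedU_adj C D x y : linked C -> linked D -> x \in C -> y \in D -> adj A x y ->
  linked (C :|: D).
Proof.
move=> lC lD xC yD xy; have l2 : linked [set x; y].
  apply: (@linked_root _ x) => z; rewrite !inE => /orP[/eqP ->//|/eqP ->].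
  by apply: connect1; rewrite /inner xy !inE !eqxx orbT.
have -> : C :|: D = (C :|: [set x; y]) :|: D.
  apply/setP => z; rewrite !inE; have [->|_] := eqVneq z x; first by rewrite xC.
  by have [->|_] := eqVneq z y; rewrite ?yD ?orbT ?orbF.
by apply: (linkedU (z := y)) => //; [apply: (linkedU (z := x))|]; rewrite ?inE ?eqxx ?orbT.
Qed.

Definition comp_in D x : {set V} := [set y in D | connect (inner D) x y].

Lemma linked_comp_in D x : x \in D -> linked (comp_in D x).
Proof.
move=> xD; have xC : x \in comp_in D x by rewrite inE xD connect0.
pose Z := [set y | connect (inner (comp_in D x)) x y].
apply: (@linked_root _ x) => y; rewrite inE => /andP[yD xy].
suff : y \in Z by rewrite inE.
apply: connect_invariant xy _; last by rewrite inE connect0.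
move=> z z'; rewrite !inE => xz zz'; apply: (connect_trans xz (connect1 _)).
have zC : z \in comp_in D x.
  by apply: (connect_invariant _ xz xC) => u v _ /and3P[].
have /and3P[azz zD z'D] := zz'; rewrite /inner azz zC inE z'D.
by move: zC; rewrite inE => /andP[_ /connect_trans -> //]; apply: connect1.
Qed.

(** Removing one branch at [r] keeps the others attached to [r]: a walk that enters the branch can
    leave it only through [r]. *)
Lemma linked_rest D r x : r \notin D -> x \in D -> linked (r |: D) ->
  linked (r |: (D :\: comp_in D x)).
Proof.
move=> rD xD lD; set D' := comp_in D x; set K := r |: _.
pose Z := [set y | connect (inner K) r y] :|: D'.
have rZ : r \in [set y | connect (inner K) r y] by rewrite inE connect0.
have RK y : y \in [set y | connect (inner K) r y] -> y \in K.
  rewrite inE => ry; apply: connect_invariant ry (setU11 _ _) => z z' _.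
  by case/and3P.
have DZ y : y \in r |: D -> y \in Z.
  move=> yD; apply: connect_invariant (linkedP lD (setU11 _ _) yD) _; last first.
    by rewrite inE rZ.
  move=> z z' /setUP[zR|zD'] /and3P[azz zD /setU1P[->|z'D]]; try by rewrite inE rZ.
    rewrite in_setU; case: (boolP (z' \in D')) => z'D'; rewrite ?orbT // orbF.
    rewrite inE; apply: connect_trans (_ : connect _ _ z) (connect1 _).
      by move: zR; rewrite inE.
    by rewrite /inner azz (RK _ zR) /K in_setU1 in_setD z'D' z'D orbT.
  rewrite in_setU; apply/orP; right; move: zD'; rewrite !inE => /andP[zD' xz].
  rewrite z'D; apply: (connect_trans xz (connect1 _)).
  by rewrite /inner azz zD' z'D.
apply: (@linked_root _ r) => y /setU1P[->|]; first exact: connect0.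
rewrite inE => /andP[yD' yD]; have := DZ y; rewrite !in_setU (negbTE yD') yD orbT orbF.
by move=> /(_ isT); rewrite inE.
Qed.

Lemma exists_adj D r : linked (r |: D) -> r \notin D -> D != set0 ->
  exists2 x, x \in D & adj A r x.
Proof.
move=> lD rD /set0Pn[y yD].
have /connectP[p pp yE] := linkedP lD (setU11 r D) (setU1r r yD).
case/shortenP: pp yE => -[|x p'] /= pp up _ yE.
  by rewrite -yE yD in rD.
move: pp => /andP[/and3P[rx _ xD] _]; exists x => //.
move: xD => /setU1P[E|//]; by move: up; rewrite E inE eqxx.
Qed.

(* A piece with too many vertices is made smaller, either by moving its apex to a
   neighbour or by splitting off a union of branches at the apex. *)
Lemma cut_piece C r0 s m D r : 0 < s -> #|D| <= m -> linked C -> r0 \in C ->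
  D \subset C -> r \in C -> r \notin D -> r0 \notin D -> linked (r |: D) ->
  linked (C :\: D) -> s <= #|D| ->
  exists r' Q, [/\ [&& r' \in C, r' \notin Q, Q \subset C & r0 \notin Q],
    (s <= #|Q|) && (#|Q| < 2 * s), linked (r' |: Q) & linked (C :\: Q)].
Proof.
move=> s0; elim: m D r => [|m IH] D r.
  by rewrite leqn0 => /eqP -> _ _ _ _ _ _ _ _; case: s s0.
move=> Dm lC r0C DC rC rD r0D lD lCD sD.
have [Ds|Ds] := ltnP #|D| (2 * s); first by exists r, D; rewrite sD Ds rC rD DC.
have D0 : D != set0 by rewrite -card_gt0 (leq_trans s0).
have [x xD rx] := exists_adj lD rD D0.
have subD : C :\: D \subset C by apply: subsetDl.
have rCD : r \in C :\: D by rewrite inE rD.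
pose D' := comp_in D x; have D'D : D' \subset D by apply/subsetP => y; rewrite inE => /andP[].
have lD' : linked D' by apply: linked_comp_in.
have xD' : x \in D' by rewrite inE xD connect0.
have D'0 : 0 < #|D'| by rewrite card_gt0; apply/set0Pn; exists x.
have cD := cardsID D' D; rewrite (setIidPr D'D) in cD.
have lrD' : linked (r |: D').
  by apply: linkedU_adj rx => //; [apply: linked1|rewrite inE].
have lrest : linked (r |: (D :\: D')) by apply: linked_rest.
(* A single branch at [r]: its vertex [x] becomes the apex and leaves the body. *)
have [DD|DD] := eqVneq D' D.
  apply: (IH (D :\ x) x) => //.
  - by move: Dm; rewrite (cardsD1 x) xD.
  - by apply: subset_trans DC; apply: subsetDl.
  - by apply: (subsetP DC).
  - by rewrite !inE eqxx.
  - by rewrite !inE negb_and r0D orbT.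
  - by rewrite setD1K // -DD.
  - have -> : C :\: (D :\ x) = (C :\: D) :|: [set x].
      apply/setP => y; rewrite !inE; have [->|_] := eqVneq y x; rewrite ?orbF //=.
      by rewrite (subsetP DC) // orbT.
    by apply: linkedU_adj rx => //; [apply: linked1|rewrite inE].
  - by move: Ds s0; rewrite (cardsD1 x) xD; move: #|_| => d; clear; lia.
have DD0 : 0 < #|D :\: D'|.
  rewrite card_gt0; apply: contra DD; rewrite setD_eq0 => DD.
  by rewrite eqEsubset D'D.
(* A branch of size at least [s] is kept alone; the other branches return to the remainder through
   [r]. *)
have [sD'|sD'] := leqP s #|D'|.
  apply: (IH D' r) => //; last 1 first.
  - have -> : C :\: D' = (C :\: D) :|: (r |: (D :\: D')).
      apply/setP => y; rewrite !(in_setU, in_set1, in_setD).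
      have [->|_] /= := eqVneq y r.
        by rewrite rC rD (contra (subsetP D'D r) rD).
      case: (boolP (y \in D)) => yD /=; rewrite ?orbF ?andbT //.
        by rewrite (subsetP DC) // andbT.
      by rewrite (contra (subsetP D'D y) yD) /= orbF.
    by apply: (linkedU (z := r)) => //; rewrite setU11.
  - by move: Dm DD0; rewrite -cD; move: #|D'| #|_| => d d'; clear; lia.
  - exact: subset_trans DC.
  - by apply: contra rD; apply: (subsetP D'D).
  - by apply: contra r0D; apply: (subsetP D'D).
(* A branch smaller than [s] is given back; more than [2 * s - s] vertices stay in the body. *)
apply: (IH (D :\: D') r) => //.
- by move: Dm D'0; rewrite -cD; move: #|D'| #|_| => d d'; clear; lia.
- by apply: subset_trans DC; apply: subsetDl.
- by rewrite inE negb_and rD orbT.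
- by rewrite inE negb_and r0D orbT.
- have -> : C :\: (D :\: D') = (C :\: D) :|: (r |: D').
    apply/setP => y; rewrite in_setU in_setU1 !in_setD; have [->|_] /= := eqVneq y r.
      by rewrite rC (negbTE rD) andbF orbT.
    case: (boolP (y \in D')) => yD' /=.
      by rewrite (subsetP DC) ?(subsetP D'D) // orbT.
    by rewrite orbF.
  by apply: (linkedU (z := r)) => //; rewrite setU11.
- by move: Ds sD'; rewrite -cD; move: #|D'| #|_| => d d'; clear; lia.
Qed.

(** * Packing components with connected pieces *)

(** The apex holds the body together. It stays outside the body because several pieces may share it,
    whereas bodies are disjoint in a packing. *)
Definition is_piece s (a : V * {set V}) :=
  [&& a.1 \notin a.2, s <= #|a.2|, #|a.2| < 2 * s & linked (a.1 |: a.2)].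

Definition packing s U (L : seq (V * {set V})) :=
  [/\ all (is_piece s) L, all (fun a : V * {set V} => a.2 \subset U) L &
      forall x, count (fun a : V * {set V} => x \in a.2) L <= 1].

Lemma packing_notin s U L x : packing s U L -> x \notin U ->
  count (fun a : V * {set V} => x \in a.2) L = 0.
Proof.
case=> _ /allP LU _ xU; apply/eqP; rewrite -leqn0 leqNgt -has_count.
by apply/hasPn => a /LU aU; apply: contra xU; apply: subsetP.
Qed.

Lemma packing_cat s U1 U2 L1 L2 : packing s U1 L1 -> packing s U2 L2 ->
  [disjoint U1 & U2] -> packing s (U1 :|: U2) (L1 ++ L2).
Proof.
move=> P1 P2 dU; have [p1 s1 c1] := P1; have [p2 s2 c2] := P2; split.
- by rewrite all_cat p1.
- rewrite all_cat; apply/andP; split.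
    by apply: sub_all s1 => a /subset_trans; apply; apply: subsetUl.
  by apply: sub_all s2 => a /subset_trans; apply; apply: subsetUr.
move=> x; rewrite count_cat; have [xU1|xU1] := boolP (x \in U1).
  by rewrite (packing_notin P2) ?addn0 // (disjointFr dU).
by rewrite (packing_notin P1) // add0n.
Qed.

(** Pieces are cut off while more than [s] vertices remain; each cut removes fewer than [2 * s] of
    them and leaves a connected rest. *)
Lemma linked_packing C s : 0 < s -> linked C -> C != set0 ->
  exists2 L, packing s C L & #|C| <= s + 2 * s * size L.
Proof.
move=> s0; have [m] := ubnP #|C|; elim: m C => // m IH C Cm lC /set0Pn[r0 r0C].
have [Cs|Cs] := leqP #|C| s.
  by exists [::]; [split|rewrite muln0 addn0].
(* The first body is everything but the root [r0], which no cut removes. *)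
have := @cut_piece C r0 s #|C| (C :\ r0) r0 s0.
rewrite setD1K // lC => /(_ _ isT r0C) [].
- by rewrite (cardsD1 r0 C) r0C leq_addl.
- exact: subsetDl.
- by [].
- by rewrite !inE eqxx.
- by rewrite !inE eqxx.
- by [].
- have -> : C :\: (C :\ r0) = [set r0]; last exact: linked1.
  by apply/setP => y; rewrite !inE; case: eqP => [->|]; rewrite ?r0C //=; case: (_ \in _).
- by move: Cs; rewrite (cardsD1 r0) r0C.
move=> r [Q [/and4P[rC rQ QC r0Q] /andP[sQ Qs] lQ lCQ]].
have cC := cardsID Q C; rewrite (setIidPr QC) in cC.
have [||L PL LC] := IH (C :\: Q) _ lCQ.
- by move: Cm s0 sQ; rewrite -cC; move: #|Q| #|_| => d d'; clear; lia.
- by apply/set0Pn; exists r0; rewrite inE r0Q.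
exists ((r, Q) :: L); last first.
  by move: LC Qs; rewrite -cC /= mulnS; move: #|Q| #|_| (2 * s * _) => d d' d''; clear; lia.
have PQ : packing s Q [:: (r, Q)].
  split; first by rewrite /= /is_piece /= rQ sQ Qs lQ.
    by rewrite /= subxx.
  by move=> x; rewrite /= addn0 leq_b1.
have QE : Q :|: (C :\: Q) = C.
  apply/setP => y; rewrite in_setU in_setD; case: (boolP (y \in Q)) => //= yQ.
  by rewrite (subsetP QC).
have := packing_cat PQ PL _; rewrite QE; apply.
by rewrite -setI_eq0; apply/eqP/setP => y; rewrite in_setI in_setD in_set0; case: (y \in Q).
Qed.

Definition comp x : {set V} := [set y | connect (adj A) x y].

Lemma linked_comp x : linked (comp x).
Proof.
pose Z := [set y | connect (inner (comp x)) x y].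
apply: (@linked_root _ x) => y; rewrite inE => xy.
suff : y \in Z by rewrite inE.
apply: connect_invariant xy _; last by rewrite inE connect0.
move=> z z'; rewrite !inE => xz zz'; apply: (connect_trans xz (connect1 _)).
have xz' : connect (adj A) x z.
  apply: connect_sub xz => u v /and3P[uv _ _]; exact: connect1.
by rewrite /inner zz' !inE xz' (connect_trans xz') ?connect1.
Qed.

(** A component with more than [s] vertices yields at least one piece, so the [s] vertices left over
    are charged to that piece and [2 * s] becomes [3 * s]. *)
Lemma large_comps_packing s : 0 < s ->
  exists2 L, packing s setT L & #|[set x | s < #|comp x|]| <= 3 * s * size L.
Proof.
move=> s0; suff H m U : #|U| < m -> (forall x y, x \in U -> adj A x y -> y \in U) ->
    exists2 L, packing s U L & #|[set x in U | s < #|comp x|]| <= 3 * s * size L.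
  have clT x y : x \in [set: V] -> adj A x y -> y \in [set: V] by rewrite !inE.
  have [L PL LC] := H #|[set: V]|.+1 setT (leqnn _) clT.
  by exists L => //; apply: leq_trans LC; apply/subset_leq_card/subsetP => x; rewrite !inE.
elim: m U => // m IH U Um clU; have [->|[x xU]] := set_0Vmem U.
  exists [::]; first by split.
  by rewrite (_ : [set _ in _ | _] = set0) ?cards0 //; apply/setP => y; rewrite !inE.
have CU : comp x \subset U.
  by apply/subsetP => y; rewrite inE => xy; apply: connect_invariant xy xU.
have cC := cardsID (comp x) U; rewrite (setIidPr CU) in cC.
have xC : x \in comp x by rewrite inE connect0.
have C0 : comp x != set0 by apply/set0Pn; exists x.
have [||L PL LC] := IH (U :\: comp x).
- by move: Um C0; rewrite -cC -card_gt0; move: #|comp x| #|_| => d d'; clear; lia.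
- move=> y z; rewrite !inE => /andP[xy yU] yz; rewrite (clU _ _ yU yz) andbT.
  apply: contra xy => xz; apply: connect_trans xz _.
  by apply: connect1; rewrite adjC.
have E : #|[set y in U | s < #|comp y|]| <=
   (if s < #|comp x| then #|comp x| else 0) + #|[set y in U :\: comp x | s < #|comp y|]|.
  have Cy y : y \in comp x -> comp y = comp x.
    rewrite inE => xy; apply/setP => z; rewrite !inE.
    by rewrite (same_connect (adj_connect_sym A) xy).
  case: ifP => sC.
    apply: leq_trans (leq_card_setU _ _); apply/subset_leq_card/subsetP => y.
    by rewrite !inE => /andP[-> ->]; rewrite !andbT orbN.
  apply/subset_leq_card/subsetP => y; rewrite !inE => /andP[-> sy]; rewrite sy !andbT.
  by apply/negP => xy; rewrite Cy ?sC // inE in sy.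
have UE : U = comp x :|: (U :\: comp x).
  by apply/setP => y; rewrite !in_setU in_setD; case: (boolP (y \in comp x)) => // /(subsetP CU).
have dU : [disjoint comp x & U :\: comp x].
  by rewrite -setI_eq0; apply/eqP/setP => y; rewrite !in_setI in_setD in_set0; case: (y \in comp x).
have [sC|sC] := ltnP s #|comp x|; last first.
  exists L; last by apply: leq_trans E _; rewrite ltnNge sC.
  have := packing_cat (_ : packing s (comp x) [::]) PL dU; rewrite -UE cat0s.
  by apply; split.
have [L' PL' LC'] := linked_packing s0 (linked_comp x) C0.
exists (L' ++ L); first by rewrite UE; apply: packing_cat.
apply: leq_trans E _; rewrite sC size_cat.
rewrite mulnDr; apply: leq_add LC; apply: (leq_trans LC').
case: L' {PL' LC'} (leq_trans sC LC') => [|a L'] /=.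
  by rewrite muln0 addn0 ltnn.
by move: (size L') s0 => l; clear; rewrite !mulnS; nia.
Qed.

Lemma arm_comp s x : arm A s set0 x -> s < #|comp x|.
Proof.
case/armP => p [<- pp up _].
rewrite -[X in X <= _]/(size (x :: p)) -(card_uniqP up).
by apply/subset_leq_card/subsetP => y yp; rewrite inE; apply: path_connect pp _ _.
Qed.

End Pieces.

(** * Lower bound by sprinkling *)

(** The exponential moment for a Chernoff bound on the lower tail of [#|S :&: F|]. *)
Lemma Ex_half (R : realType) (T : finType) (p : R) (es : seq T) (F A : {set T}) :
  uniq es -> (forall e, e \in es -> e \notin A) ->
  Ex p es (fun S => (1 / 2) ^+ #|S :&: F|) A =
  (1 / 2) ^+ #|A :&: F| * (1 - p / 2) ^+ count (mem F) es.
Proof.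
elim: es A => [|e es IH] A /=; first by rewrite expr0 mulr1.
move=> /andP[ees ues] eA; rewrite !IH //; last 2 first.
- move=> e' e'es; rewrite !inE negb_or eA ?inE ?e'es ?orbT // andbT.
  by apply: contraNneq ees => <-.
- by move=> e' e'es; rewrite eA // inE e'es orbT.
rewrite setIUl; have [eF|eF] := boolP (e \in F).
  have -> : [set e] :&: F = [set e] by apply/setIidPl; rewrite sub1set.
  rewrite cardsU1 inE (negbTE (eA e (mem_head _ _))) /=.
  by rewrite add1n exprS [(1 - p / 2) ^+ _.+1]exprS; lra.
have -> : [set e] :&: F = set0 by apply/eqP; rewrite setI_eq0 disjoints1.
by rewrite set0U add0n; lra.
Qed.

Section Colourings.
Variable n : nat.
Local Notation V := 'I_n.
Local Notation graph := {set V * V}.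
Variables (B : graph) (s : nat) (U : {set V}) (L : seq (V * {set V})).
Hypothesis PL : packing B s U L.
Implicit Types (C D Q X Y : {set V}) (x y z : V).
Local Open Scope nat_scope.

Definition proper_on X C := [forall q in B,
  [&& q.1 < q.2, q.1 \in C & q.2 \in C] ==> ((q.1 \in X) != (q.2 \in X))].

(** Both colourings change along every edge, so whether they agree is constant on a connected
    set. *)
Lemma proper_flip C X Y r x : linked B C -> proper_on X C -> proper_on Y C ->
  r \in C -> x \in C -> (x \in X) (+) (x \in Y) = (r \in X) (+) (r \in Y).
Proof.
move=> lC pX pY rC xC; pose Z := [set y | (y \in X) (+) (y \in Y) == (r \in X) (+) (r \in Y)].
have : x \in Z; last by rewrite inE => /eqP.
apply: connect_invariant (linkedP lC rC xC) _; last by rewrite inE.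
move=> z z'; rewrite !inE => /eqP <- /and3P[zz' zC z'C].
have [->//|nz] := eqVneq z z'.
have H W : proper_on W C -> (z \in W) = ~~ (z' \in W).
  move=> /forall_inP/(_ _ zz')/implyP; rewrite edge_pair //.
  rewrite /edge; case: ifP => _ /=; rewrite zC z'C => /(_ isT);
  by case: (z \in W); case: (z' \in W).
by rewrite (H X) // (H Y) //; case: (_ \in X); case: (_ \in Y).
Qed.

Local Notation N := (size L).
Definition apex (i : 'I_N) : V := (tnth (in_tuple L) i).1.
Definition body (i : 'I_N) : {set V} := (tnth (in_tuple L) i).2.
Local Notation piece i := (apex i |: body i).

Lemma piece_in i : tnth (in_tuple L) i \in L.
Proof. exact: mem_tnth. Qed.

Lemma sum_body x : \sum_i (x \in body i) <= 1.
Proof.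
have [_ _ /(_ x)] := PL; rewrite -sum1_count big_mkcond big_tnth; apply: leq_trans.
by apply: leq_sum => i _; rewrite /body; case: (x \in _).
Qed.

Lemma body_inj x i j : x \in body i -> x \in body j -> i = j.
Proof.
move=> xi xj; apply/eqP/negPn/negP => ij; have := sum_body x.
by rewrite (bigD1 i) //= (bigD1 j) 1?eq_sym //= xi xj.
Qed.

Lemma linked_piece i : linked B (piece i).
Proof. by have [/allP/(_ _ (piece_in i))/and4P[]] := PL. Qed.

Lemma card_body i : s <= #|body i|.
Proof. by have [/allP/(_ _ (piece_in i))/and4P[]] := PL. Qed.

(** The default [set0] is harmless: it occurs only if no colouring is proper on the piece, and then
    every trace is [None] there. *)
Definition ref_colour i : {set V} := odflt set0 [pick X | proper_on X (piece i)].

(* What a colouring [X] does to each piece: [None] if an edge of [B] inside the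
   piece is monochromatic, and otherwise which of the only two proper colourings
   of the piece it induces. *)
Definition trace X : {ffun 'I_N -> option bool} :=
  [ffun i => if proper_on X (piece i)
             then Some ((apex i \in X) (+) (apex i \in ref_colour i)) else None].

(** The vertices whose colour is forced to be [b] by [t], so that pairs inside one side are
    monochromatic for every colouring with trace [t]. *)
Definition side (t : {ffun 'I_N -> option bool}) b : {set V} :=
  [set x | [exists i, (x \in body i) &&
    (if t i is Some c then (x \in ref_colour i) (+) c == b else false)]].

Lemma side_trace X b x : x \in side (trace X) b -> (x \in X) = b.
Proof.
rewrite inE => /existsP[i /andP[xi]]; rewrite ffunE; case: ifP => // pX /eqP <-.
have pR : proper_on (ref_colour i) (piece i).
  by rewrite /ref_colour; case: pickP => [Y //|/(_ X)]; rewrite pX.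
have := proper_flip (linked_piece i) pX pR (setU11 _ _) (setU1r (apex i) xi).
by case: (_ \in X); case: (_ \in X); case: (_ \in ref_colour i); case: (_ \in ref_colour i).
Qed.

Definition side_pairs t : graph := [set q : V * V | (q.1 < q.2) &&
  ((q.1 \in side t true) && (q.2 \in side t true) ||
   (q.1 \in side t false) && (q.2 \in side t false))].

Lemma side_pairs_mono S X : S :&: side_pairs (trace X) \subset mono S X.
Proof.
apply/subsetP => q; rewrite in_setI => /andP[qS].
rewrite in_set => /andP[qlt /orP[]] /andP[/side_trace E1 /side_trace E2];
by rewrite in_set qS qlt E1 E2.
Qed.

(** A broken piece contains a monochromatic edge with an end in its body, since the apex is one
    vertex, and each of the two ends of an edge lies in at most one body. *)
Lemma broken_le X : #|[set i | trace X i == None]| <= 2 * #|mono B X|.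
Proof.
apply: (@leq_trans (\sum_i \sum_(q in mono B X) ((q.1 \in body i) + (q.2 \in body i)))).
  rewrite -sum1dep_card big_mkcond; apply: leq_sum => i _.
  rewrite ffunE; case: (boolP (proper_on X (apex i |: body i))) => //=.
  rewrite negb_forall_in => /exists_inP[q qB]; rewrite negb_imply negbK.
  move=> /andP[/and3P[qlt q1 q2] qX].
  rewrite (bigD1 q) /=; last by rewrite inE qB qlt.
  apply: leq_trans (leq_addr _ _); move: q1 q2; rewrite !in_setU1.
  case: (q.1 \in body i) => //; case: (q.2 \in body i) => //; rewrite !orbF.
  by move=> /eqP E1 /eqP E2; rewrite E1 E2 ltnn in qlt.
rewrite exchange_big mulnC -sum_nat_const; apply: leq_sum => q _.
by rewrite big_split (leq_add (sum_body _) (sum_body _)).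
Qed.

Lemma card_ordered_pairs X :
  #|X| ^ 2 <= 2 * #|[set q : V * V | (q.1 < q.2) && ((q.1 \in X) && (q.2 \in X))]| + #|X|.
Proof.
set F := [set _ | _]; rewrite expnS expn1 -cardsX mul2n -addnn.
pose F' := [set (q.2, q.1) | q in F]; pose F0 := [set (x, x) | x in X].
have c' : #|F'| = #|F| by apply: card_imset => -[x y] [x' y'] [-> ->].
have c0 : #|F0| = #|X| by apply: card_imset => x y [].
rewrite -[X in X + _ + _]c' -c0; apply: (@leq_trans #|F' :|: F :|: F0|).
  apply/subset_leq_card/subsetP => -[x y]; rewrite in_setX => /andP[/= xX yX].
  rewrite !in_setU; case: (ltngtP x y) => xy.
  - by rewrite [(x, y) \in F]inE /= xy xX yX orbT.
  - apply/orP; left; apply/orP; left; apply/imsetP; exists (y, x) => //.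
    by rewrite inE /= xy xX yX.
  - by apply/orP; right; apply/imsetP; exists x => //; rewrite (val_inj xy).
by apply: leq_trans (leq_card_setU _ _) _; rewrite leq_add2r leq_card_setU.
Qed.

(** At least [N - 2 * k] pieces are unbroken, so the two sides have at least [W] vertices together;
    the pairs inside them are fewest when the sides are equal. *)
Lemma card_side_pairs (t : {ffun 'I_N -> option bool}) k W : #|[set i | t i == None]| <= 2 * k ->
  W = s * (N - 2 * k) -> 1 < W -> W ^ 2 <= 4 * #|side_pairs t| + 2 * W.
Proof.
move=> tk WE W1.
have sD : [disjoint side t true & side t false].
  rewrite -setI_eq0; apply/eqP/setP => x; rewrite !inE; apply/negbTE/negP.
  move=> /andP[/existsP[i /andP[xi ti]] /existsP[j /andP[xj]]].
  by rewrite -(body_inj xi xj); case: (t i) ti => // c /eqP ->.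
pose a := #|side t true|; pose b := #|side t false|.
have Wab : W <= a + b.
  have -> : a + b = #|side t true :|: side t false|.
    by rewrite cardsU (eqP (_ : _ :&: _ == set0)) ?setI_eq0 // cards0 subn0.
  apply: (@leq_trans (\sum_(i | t i != None) #|body i|)).
    apply: (@leq_trans (\sum_(i | t i != None) s)); last by apply: leq_sum => i _; apply: card_body.
    rewrite sum_nat_cond_const WE mulnC leq_mul2r; apply/orP; right.
    rewrite leq_subLR; apply: leq_trans (leq_add tk (leqnn _)).
    rewrite -[X in X <= _]card_ord -cardsT -(cardsID [set i | t i == None]) setTI leq_add2l.
    by apply/subset_leq_card/subsetP => i; rewrite !inE andbT.
  under eq_bigr do rewrite -sum1_card big_mkcond.
  rewrite exchange_big -sum1_card [X in _ <= X]big_mkcond /=; apply: leq_sum => x _.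
  case: ifP => [_|/negbT xS].
    apply: leq_trans (sum_body x); rewrite big_mkcond; apply: leq_sum => i _.
    by case: ifP => // _; case: (x \in body i).
  rewrite big1 // => i ti; case: ifP => // xi; case/negP: xS.
  case tE: (t i) ti => [c|//] _; rewrite !inE.
  case xR: ((x \in ref_colour i) (+) c); apply/orP; [left|right];
  by apply/existsP; exists i; rewrite xi tE xR.
pose F b := [set q : V * V | (q.1 < q.2) && ((q.1 \in side t b) && (q.2 \in side t b))].
have FE : #|F true| + #|F false| <= #|side_pairs t|.
  rewrite -cardsUI (eqP (_ : F true :&: F false == set0)); last first.
    apply/eqP/setP => q; rewrite in_setI in_set0 ![q \in F _]in_set; apply/negbTE/negP.
    move=> /andP[/and3P[_ q1 _] /and3P[_ q1' _]].
    by rewrite (disjointFr sD q1) in q1'.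
  rewrite cards0 addn0; apply/subset_leq_card/subsetP => q.
  by case/setUP; rewrite [_ \in F _]in_set [_ \in side_pairs _]in_set =>
    /and3P[-> -> ->]; rewrite ?orbT.
have := card_ordered_pairs (side t true); have := card_ordered_pairs (side t false).
rewrite -/(F true) -/(F false) -/a -/b; move: FE Wab W1; clear.
move: #|F true| #|F false| #|side_pairs t| a b => f1 f2 f a b fle Wab W1 hb ha.
have ab : (a + b) ^ 2 <= 4 * f + 2 * (a + b).
  by have := (nat_Cauchy a b).1; rewrite sqrnD; move: fle ha hb; rewrite !expnS !expn0; lia.
(* The function [w ^ 2 - 2 w] increases from 1 on, so the bound passes from [a + b] down to [W]. *)
move: ab; rewrite -(subnKC Wab); move: (a + b - W) => d; rewrite !expnS !expn0; nia.
Qed.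

End Colourings.

(* Union bound over the [3 ^ size L] possible traces. *)
Lemma sprinkle_tail (R : realType) (n : nat) (q : R) (B : {set 'I_n * 'I_n}) s U L k W M :
  0 <= q <= 1 -> packing B s U L -> W = (s * (size L - 2 * k))%N -> (1 < W)%N ->
  (4 * M + 2 * W <= W ^ 2)%N ->
  Ex q (pairs n) (fun D => (distB D <= k)%N%:R) B <=
  3 ^+ size L * (2 ^+ k * (1 - q / 2) ^+ M).
Proof.
move=> q01 PL WE W1 MW; have /andP[q0 q1] := q01.
pose ok (t : {ffun 'I_(size L) -> option bool}) := (#|[set i | t i == None]| <= 2 * k)%N.
rewrite -(setU0 B) Ex_shift.
(* If [distB] is at most [k], the trace of an optimal colouring has at most [k] forced pairs among
   the new edges, and its term is at least [2 ^ k / 2 ^ k]. *)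
apply: (@le_trans _ _ (\sum_(t | ok t)
   2 ^+ k * Ex q (pairs n) (fun S => (1 / 2) ^+ #|S :&: side_pairs B t|) set0)).
  under eq_bigr do rewrite -ExZ.
  rewrite -Ex_sum; apply: Ex_le => // S.
  have h0 m : 0 <= 2 ^+ k * (1 / 2) ^+ m :> R.
    by rewrite mulr_ge0 ?exprn_ge0 // divr_ge0.
  have [dk|_] := leqP; last by apply: sumr_ge0 => t _; apply: h0.
  have [X XE] := distB_ex (B :|: S); rewrite XE in dk.
  have mS (D : {set 'I_n * 'I_n}) : D \subset B :|: S -> (#|mono D X| <= k)%N.
    move=> DB; apply: leq_trans dk; apply/subset_leq_card/subsetP => e.
    by rewrite !in_set => /andP[/(subsetP DB) + ->]; rewrite in_setU => ->.
  have okX : ok (trace B L X).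
    apply: leq_trans (broken_le PL X) _; rewrite leq_mul2l /=.
    by apply: mS; apply: subsetUl.
  rewrite (bigD1 (trace B L X)) //=; set m := #|_|.
  have mk : (m <= k)%N.
    apply: leq_trans (mS S (subsetUr _ _)).
    by apply/subset_leq_card; apply: side_pairs_mono PL _ _.
  rewrite -[leLHS]addr0; apply: lerD; last by apply: sumr_ge0 => t _; apply: h0.
  have E2 : 2 * (1 / 2) = 1 :> R by lra.
  rewrite -(subnK mk) exprD -mulrA -exprMn E2 expr1n mulr1.
  by apply: exprn_ege1; rewrite ler1n.
apply: (@le_trans _ _ (\sum_(t | ok t) 2 ^+ k * (1 - q / 2) ^+ M)).
  apply: ler_sum => t okt; rewrite ler_wpM2l ?exprn_ge0 //.
  rewrite Ex_half ?pairs_uniq //; last by move=> e _; rewrite inE.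
  rewrite set0I cards0 expr0 mul1r.
  have -> : count (mem (side_pairs B t)) (pairs n) = #|side_pairs B t|.
    rewrite -size_filter -[LHS](card_uniqP _); last exact: (filter_uniq _ (pairs_uniq n)).
    apply: eq_card => e; rewrite mem_filter /= mem_pairs andb_idr //.
    by rewrite in_set => /andP[].
  apply: ler_wiXn2l; [lra|lra|].
  have := card_side_pairs PL okt WE W1; move: MW; clear.
  move: #|_| => f; lia.
rewrite sumr_const -[leLHS]mulr_natl ler_wpM2r ?mulr_ge0 ?exprn_ge0 //; first by lra.
rewrite -natrX ler_nat; apply: leq_trans (max_card _) _.
by rewrite card_ffun card_option card_bool card_ord.
Qed.

(** With [3 <= exp 2], [2 <= exp 1] and [1 - x <= exp (- x)] the product is at most
    [exp (2 N + N - 4 N)], and [exp (- 1) <= 1 / 2]. *)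
Lemma union_bound_small (R : realType) (q : R) (N k M : nat) : 0 <= q <= 1 ->
  (0 < N)%N -> (k <= N)%N -> 4 * N%:R <= q / 2 * M%:R ->
  3 ^+ N * (2 ^+ k * (1 - q / 2) ^+ M) <= 1 / 2.
Proof.
move=> /andP[q0 q1] N0 kN qM.
have e2 : 2 <= sequences.expR 1 :> R by have := exp.expR_ge1Dx (1 : R); lra.
have e3 : 3 <= sequences.expR 2 :> R by have := exp.expR_ge1Dx (2 : R); lra.
have H3 : 3 ^+ N <= sequences.expR (N%:R * 2) :> R.
  by rewrite exp.expRM_natl lerXn2r ?nnegrE ?exp.expR_ge0.
have H2 : 2 ^+ k <= sequences.expR (k%:R * 1) :> R.
  by rewrite exp.expRM_natl lerXn2r ?nnegrE ?exp.expR_ge0.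
have HM : (1 - q / 2) ^+ M <= sequences.expR (M%:R * (- (q / 2))).
  rewrite exp.expRM_natl lerXn2r ?nnegrE ?exp.expR_ge0 //; first by lra.
  by have := exp.expR_ge1Dx (- (q / 2)).
apply: (@le_trans _ _ (sequences.expR (N%:R * 2) *
    (sequences.expR (k%:R * 1) * sequences.expR (M%:R * (- (q / 2)))))).
  have q2 : 0 <= 1 - q / 2 by lra.
  by rewrite !ler_pM ?mulr_ge0 ?exprn_ge0.
rewrite -!exp.expRD; apply: (@le_trans _ _ (sequences.expR (- N%:R))).
  have kN' : k%:R <= N%:R :> R by rewrite ler_nat.
  by rewrite exp.ler_expR; lra.
rewrite exp.expRN -div1r ler_pdivrMr ?exp.expR_gt0 //.
have := exp.expR_ge1Dx (N%:R : R); have : 1 <= N%:R :> R by rewrite ler1n.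
lra.
Qed.

(** Markov's inequality in reverse: the count has mean at least [x n] and never exceeds [n]. *)
Lemma many_vertices_on_arms (R : realType) (n : nat) (p x : R) s :
  0 <= p <= 1 / 2 -> (0 < n)%N -> 0 <= x ->
  (forall v : 'I_n, x <= Pr p (fun A => arm A s set0 v)) ->
  x / 2 <= Pr p (fun A : {set 'I_n * 'I_n} => x / 2 * n%:R <= (#|[set v | arm A s set0 v]|)%:R).
Proof.
move=> p2 n0 x0 Hx; have /andP[p0 p12] := p2; have p01 : 0 <= p <= 1 by rewrite p0; lra.
have nR : 0 < n%:R :> R by rewrite ltr0n.
pose Y (A : {set 'I_n * 'I_n}) : R := (#|[set v | arm A s set0 v]|)%:R.
have EY : n%:R * x <= Ex p (pairs n) Y set0.
  rewrite (@eq_Ex _ _ _ _ _ (fun A => \sum_v (arm A s set0 v)%:R)); last first.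
    by move=> A; rewrite /Y natr_card_set.
  rewrite Ex_sum -[n in n%:R]card_ord mulr_natl -sumr_const.
  by apply: ler_sum => v _; apply: Hx.
have YP : Ex p (pairs n) Y set0 <= x / 2 * n%:R +
    n%:R * Pr p (fun A => x / 2 * n%:R <= Y A).
  rewrite -[X in X + _](Ex_cst p (pairs n) (x / 2 * n%:R) set0) -ExZ -ExD.
  apply: Ex_le => // A; case: (leP _ (Y A)) => [_|/ltW]; last by rewrite mulr0 addr0.
  rewrite mulr1 -[leLHS]add0r lerD //; first by rewrite mulr_ge0 ?divr_ge0.
  by rewrite ler_nat -[X in (_ <= X)%N]card_ord max_card.
rewrite -(ler_pM2l nR); move: EY YP; rewrite /Y; lra.
Qed.

Lemma piece_size_ex (R : realType) (eps : R) : 0 < eps -> eps < 1 ->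
  exists s : nat, [/\ (32 <= s)%N, 192 * 256 <= s%:R * eps ^+ 2 &
                      s%:R * eps ^+ 2 <= 2000 * 25].
Proof.
move=> e0 e1; have e20 : 0 < eps ^+ 2 by rewrite exprn_gt0.
have e21 : eps ^+ 2 <= 1 by rewrite expr_le1 // ltW.
(* [s] is [K / eps ^ 2] rounded up; rounding adds at most [eps ^ 2 <= 1], within the slack up to
   50000. *)
pose K : R := 192 * 256; have K0 : 0 <= K by rewrite mulr_ge0.
have K32 : 32 <= K by rewrite /K; lra.
have /andP[] := truncn_itv (divr_ge0 K0 (ltW e20)).
move: (Num.truncn _) => t tle tlt.
have s1 : K <= t.+1%:R * eps ^+ 2 by rewrite -ler_pdivrMr // ltW.
exists t.+1; split=> //.
  by rewrite -(ler_nat R); apply: le_trans K32 _; apply: le_trans s1 _; rewrite ler_piMr.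
have : t%:R * eps ^+ 2 <= K by rewrite -ler_pdivlMr.
by rewrite -natr1 mulrDl mul1r /K; lra.
Qed.

(** The constant is [192 * 256 = 8 * 24 * 256]: chaining the hypotheses gives
    [192 * 256 * n N <= 24 * 256 * q n M], that is [8 N <= q M]. *)
Lemma sprinkled_edges_suffice (R : realType) (eps q n N s M : R) :
  0 < eps -> 0 < n -> 0 <= N -> 0 < s -> 192 * 256 <= s * eps ^+ 2 ->
  eps / 2 <= q * n -> eps * n <= 24 * s * N -> s * N * (s * N) <= 128 * M ->
  4 * N <= q / 2 * M.
Proof.
move=> e0 n0 N0 s0 se qn nN sM.
have M0 : 0 <= M.
  have : 0 <= s * N * (s * N) by rewrite mulr_ge0 // mulr_ge0 // ltW.
  lra.
have e1 : eps * (s * N * (s * N)) <= 256 * (q * n * M).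
  have := ler_wpM2r M0 qn; have := ler_wpM2l (ltW e0) sM; lra.
have sN0 : 0 <= s * N by rewrite mulr_ge0 // ltW.
have e2 : 192 * 256 * n * N <= 24 * (eps * (s * N * (s * N))).
  have nN0 : 0 <= n * N by rewrite mulr_ge0 // ltW.
  have H1 := ler_wpM2r nN0 se.
  have esN : 0 <= eps * s * N by rewrite mulr_ge0 // mulr_ge0 ?ltW.
  have := ler_wpM2r esN nN; move: H1; rewrite expr2; lra.
rewrite -(ler_pM2r n0); lra.
Qed.

Lemma div16_bounds (W m : nat) : (16 <= W)%N -> (m <= 2 * W)%N ->
  (4 * (W ^ 2 %/ 16) + 2 * W <= W ^ 2)%N /\ (m * m <= 128 * (W ^ 2 %/ 16))%N.
Proof.
move=> Wbig mW; have := leq_divM (W ^ 2) 16; have : (W ^ 2 < (W ^ 2 %/ 16).+1 * 16)%N.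
  exact: ltn_ceil.
move: (W ^ 2 %/ 16)%N => M; rewrite !expnS expn0 muln1 => H1 H2.
by split; nia.
Qed.

(** There are at least [eps n / (24 s)] pieces and [k] is at most [eps n / (96 s)], so at most half
    of the pieces are broken and the sides cover at least half of [s * N]. *)
Lemma sprinkling_succeeds (R : realType) (n s k : nat) (eps q : R) (B : {set 'I_n * 'I_n}) :
  0 < eps -> (0 < n)%N -> (32 <= s)%N -> 192 * 256 <= s%:R * eps ^+ 2 ->
  0 <= q <= 1 -> eps / 2 <= q * n%:R -> k%:R * (96 * s%:R) <= eps * n%:R ->
  eps / 8 * n%:R <= (#|[set v | arm B s set0 v]|)%:R ->
  1 / 2 <= Ex q (pairs n) (fun D => (k < distB D)%N%:R) B.
Proof.
move=> e0 n0 s32 se q01 qn kx gB; have s0 : (0 < s)%N by apply: leq_trans s32.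
have nR : 0 < n%:R :> R by rewrite ltr0n.
have sR : 0 < s%:R :> R by rewrite ltr0n.
have [L PL LY] := large_comps_packing B s0.
have YN : eps / 8 * n%:R <= 3 * s%:R * (size L)%:R.
  apply: le_trans gB _; rewrite -!natrM ler_nat; apply: leq_trans LY.
  by apply/subset_leq_card/subsetP => v; rewrite !inE; apply: arm_comp.
set N := size L in YN.
have YN' : eps * n%:R <= 24 * s%:R * N%:R by move: YN; clear; lra.
have N0 : (0 < N)%N.
  rewrite lt0n; apply: contraTneq YN' => ->; rewrite mulr0 -ltNge.
  by rewrite mulr_gt0.
have kN : (4 * k <= N)%N.
  rewrite -(ler_nat R) natrM -(ler_pM2r (_ : 0 < 24 * s%:R)) ?mulr_gt0 //.
  by move: kx YN'; clear; lra.
pose W := (s * (N - 2 * k))%N; pose M := (W ^ 2 %/ 16)%N.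
have W2 : (s * N <= 2 * W)%N.
  by rewrite /W mulnCA leq_mul2l; apply/orP; right; move: kN; clear; lia.
have Wbig : (16 <= W)%N.
  have : (32 * 1 <= s * N)%N by apply: leq_mul.
  by move: W2; clear; lia.
have [M1 M2] := div16_bounds Wbig W2.
have T : Ex q (pairs n) (fun D => (distB D <= k)%N%:R) B <= 1 / 2.
  apply: le_trans (sprinkle_tail q01 PL (erefl W) _ M1) _.
    by move: Wbig; clear; lia.
  apply: union_bound_small => //; first by move: kN; clear; lia.
  apply: (sprinkled_edges_suffice e0 nR (ler0n _ _) sR se qn YN').
  by rewrite -!natrM ler_nat.
have : Ex q (pairs n) (fun D => (distB D <= k)%N%:R) B +
       Ex q (pairs n) (fun D => (k < distB D)%N%:R) B = 1.
  rewrite -ExD -[RHS](Ex_cst q (pairs n) 1 B); apply: eq_Ex => D.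
  by case: leqP => _; rewrite ?addr0 ?add0r.
move: T; clear; lra.
Qed.

(** The probability obtained is only of order [eps], but it does not depend on [n]; concentration
    makes up for this. *)
Lemma prob_distB_lower (R : realType) (eps : R) : 0 < eps -> eps < 1 ->
  exists n0 : nat, forall n, (n0 <= n)%N ->
    eps / 16 <= Pr ((1 + eps) / n%:R)
      (fun A : {set 'I_n * 'I_n} =>
         1 / (96 * (2000 * 25)) * eps ^+ 3 * n%:R < (distB A)%:R).
Proof.
move=> e0 e1; have [s [s32 s1 s2]] := piece_size_ex e0 e1.
have h0 : 0 < eps / 2 by clear s1 s2; lra.
have h1 : eps / 2 <= 1 / 2 by clear s1 s2; lra.
have [n1 Hn1] := arm_lower s h0 h1.
exists (maxn n1 4) => n; rewrite geq_max => /andP[nn1 n4'].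
have n4 : 4 <= n%:R :> R by rewrite (ler_nat R 4).
have n0' : (0 < n)%N by apply: leq_trans n4'.
have n0 : 0 < n%:R :> R by rewrite ltr0n.
have nV : n%:R * n%:R^-1 = 1 :> R by rewrite divff // gt_eqF.
have sR : 0 < s%:R :> R by rewrite ltr0n (leq_trans _ s32).
have small k A : eps * n%:R < k.+1%:R * (96 * s%:R) -> (k < distB A)%N ->
    1 / (96 * (2000 * 25)) * eps ^+ 3 * n%:R < (distB (n := n) A)%:R.
  rewrite -(ler_nat R) => xk kd; apply: lt_le_trans kd.
  rewrite -(ltr_pM2r (_ : 0 < 96 * s%:R)) ?mulr_gt0 //; apply: le_lt_trans xk.
  have en : 0 <= eps * n%:R by rewrite mulr_ge0 ?ltW.
  move: (ler_wpM2l en s2); rewrite [eps ^+ 3]exprS; move: en; clear; lra.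
(* [k] is the integer part of [eps n / (96 s)]; exceeding it means reaching this value, of order
   [eps ^ 3 n] as [s] is at most a constant over [eps ^ 2]. *)
have [k kx xk] : exists2 k : nat, k%:R * (96 * s%:R) <= eps * n%:R &
    eps * n%:R < k.+1%:R * (96 * s%:R).
  have s96 : 0 < 96 * s%:R :> R by rewrite mulr_gt0.
  have x0 : 0 <= eps * n%:R / (96 * s%:R) by apply: divr_ge0; rewrite ?mulr_ge0 ?ltW.
  have /andP[kx xk] := truncn_itv x0; exists (Num.truncn (eps * n%:R / (96 * s%:R))).
    by rewrite -ler_pdivlMr.
  by rewrite -ltr_pdivrMr.
have sprinkle := fun q B => @sprinkling_succeeds R n s k eps q B e0 n0' s32 s1.
move: small => /(_ k _ xk) small.
have armP1 p1 : n%:R * p1 = 1 + eps / 2 -> forall v : 'I_n,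
   eps / 4 <= Pr p1 (fun A => arm A s set0 v).
  by move=> np1 v; apply: le_trans (Hn1 n p1 nn1 np1 v); clear; lra.
clear Hn1 s1 s2 sR s32 h0 h1 nn1 xk.
set p := (1 + eps) / n%:R; pose p1 : R := (1 + eps / 2) / n%:R.
pose q : R := (eps / 2) / (n%:R - 1 - eps / 2).
have np1E : n%:R * p1 = 1 + eps / 2 by rewrite /p1 mulrCA nV mulr1.
have p2 : 0 <= p <= 1 / 2 by rewrite /p divr_ge0 ?ler_pdivrMr //; lra.
have p12 : 0 <= p1 <= 1 / 2 by rewrite /p1 divr_ge0 ?ler_pdivrMr //; lra.
have q01 : 0 <= q <= 1 by rewrite /q divr_ge0 ?ler_pdivrMr //; lra.
have qn : eps / 2 <= q * n%:R by rewrite /q mulrAC ler_pdivlMr; nra.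
have spr : 1 - p = (1 - p1) * (1 - q).
  by rewrite /p /p1 /q; field; rewrite !gt_eqF //; lra.
have p101 : 0 <= p1 <= 1 by case/andP: p12 => -> /=; lra.
pose good (B : {set 'I_n * 'I_n}) := eps / 8 * n%:R <= (#|[set v | arm B s set0 v]|)%:R.
have Pgood : eps / 8 <= Pr p1 good.
  have := many_vertices_on_arms (x := eps / 4) (s := s) p12 n0'.
  have -> : eps / 4 / 2 = eps / 8 by lra.
  by apply; [lra|exact: armP1].
rewrite /Pr (Ex_sprinkle _ _ _ spr).
apply: (@le_trans _ _ (1 / 2 * Pr p1 good)); first by move: Pgood; clear; lra.
rewrite -ExZ; apply: Ex_le => // B.
apply: (@le_trans _ _ (Ex q (pairs n) (fun D => (k < distB D)%N%:R) B)).
  case: (boolP (good B)) => [gB|_]; rewrite ?mulr1 ?mulr0; first exact: sprinkle.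
  by apply: Ex_ge0.
by apply: Ex_le => // D; case: (boolP (k < distB D)%N) => [/small ->//|_]; exact: ler0n.
Qed.

(** * Concentration *)

Section ErrorTerm.
Variables (R : realType) (n : nat) (p : R).
Hypothesis p2 : 0 <= p <= 1 / 2.
Hypothesis np : n%:R * p <= 2.
Local Notation graph := {set 'I_n * 'I_n}.

Let p01 : 0 <= p <= 1. Proof. by case/andP: p2 => p0 p12; apply/andP; split; lra. Qed.
Let p0 : 0 <= p. Proof. by case/andP: p2. Qed.

Lemma Pr_edges_le (I : graph) : Pr p (fun A => I \subset A) <= p ^+ #|I|.
Proof. by have := Ex_subset_le I set0 p01 (pairs_uniq n); rewrite setD0. Qed.

Lemma Ex_short L : Ex p (pairs n) (fun A => (#|short L A|)%:R) set0 <= 2 * L%:R.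
Proof.
pose J := [set q : 'I_n * 'I_n | (q.1 < q.2)%N && (q.2 < q.1 + L)%N].
have JL : (#|J| <= n * L)%N.
  have [L0|L0] := posnP L.
    rewrite L0 muln0 leqn0 cards_eq0; apply/eqP/setP => q; rewrite !inE L0 addn0.
    by case: ltngtP.
  rewrite -[X in (X * _)%N](card_ord n) -[X in (_ * X)%N](card_ord L) -card_prod.
  pose g (q : 'I_n * 'I_n) : 'I_n * 'I_L := (q.1, Ordinal (ltn_pmod (q.2 - q.1) L0)).
  rewrite -(card_in_imset (f := g) (D := J)); first exact: max_card.
  move=> [x y] [x' y']; rewrite !inE /= => /andP[xy yL] /andP[xy' yL'] E.
  have /= xE := congr1 fst E; have /= := congr1 (fun z => val z.2) E.
  rewrite -{}xE in xy' yL' *; rewrite !modn_small; try lia.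
  by move=> yE; congr (_, _); apply/val_inj => /=; lia.
apply: (@le_trans _ _ (\sum_(q in J) Pr p (fun A => [set q] \subset A))).
  rewrite /Pr -Ex_sum; apply: Ex_le => // A; rewrite -natr_sum ler_nat -sum1_card.
  rewrite big_mkcond [leqRHS]big_mkcond /=; apply: leq_sum => q _.
  rewrite !inE sub1set; case: (q \in A) => //=; by case: ifP.
apply: (@le_trans _ _ (\sum_(q in J) p)).
  by apply: ler_sum => q _; apply: le_trans (Pr_edges_le _) _; rewrite cards1 expr1.
rewrite sumr_const -[leLHS]mulr_natl; apply: (@le_trans _ _ ((n * L)%:R * p)).
  by rewrite ler_wpM2r // ler_nat.
by rewrite natrM mulrAC ler_wpM2r.
Qed.

(** Ordered pairs of edges at [v]: equal ones contribute at most [n p <= 2], distinct ones at most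
    [(n p) ^ 2 <= 4]. *)
Lemma Ex_deg2 v : Ex p (pairs n) (fun A => (deg A v ^ 2)%:R) set0 <= 6.
Proof.
pose I w w' : graph := [set edge v w; edge v w'].
apply: (@le_trans _ _ (\sum_(w | w != v) \sum_(w' | w' != v) Pr p (fun A => I w w' \subset A))).
  rewrite /Pr; under eq_bigr do rewrite -Ex_sum; rewrite -Ex_sum; apply: Ex_le => // A.
  under eq_bigr do rewrite -natr_sum; rewrite -natr_sum ler_nat expnS expn1.
  rewrite {1}/deg -sum1_card big_distrl /=.
  rewrite (eq_bigl (fun w => (w != v) && adj A v w)); last by move=> w; rewrite inE.
  rewrite big_mkcondr; apply: leq_sum => w _; case: ifP => // vw; rewrite mul1n.
  rewrite /deg -sum1_card (eq_bigl (fun w => (w != v) && adj A v w)); last first.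
    by move=> w'; rewrite inE.
  rewrite big_mkcondr; apply: leq_sum => w' _; case: ifP => // vw'.
  by rewrite subUset !sub1set [edge v w \in A]vw [edge v w' \in A]vw'.
have H w w' : w != v -> w' != v -> Pr p (fun A => I w w' \subset A) <= (w == w')%:R * p + p ^+ 2.
  move=> wv wv'; apply: le_trans (Pr_edges_le _) _; have [<-|ww] := eqVneq w w'.
    by rewrite /I setUid cards1 expr1 mul1r lerDl sqr_ge0.
  rewrite mul0r add0r /I cards2 (_ : edge v w != edge v w') //.
  by apply: contra ww => /eqP/edge_inj[[_ ->]|[<- ->]].
apply: (@le_trans _ _ (\sum_(w | w != v) \sum_(w' | w' != v) ((w == w')%:R * p + p ^+ 2))).
  by apply: ler_sum => w wv; apply: ler_sum => w' wv'; apply: H.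
apply: (@le_trans _ _ (\sum_(w : 'I_n) \sum_(w' : 'I_n) ((w == w')%:R * p + p ^+ 2))).
  have h0 w w' : 0 <= (w == w' :> 'I_n)%:R * p + p ^+ 2.
    by rewrite addr_ge0 ?sqr_ge0 // mulr_ge0.
  rewrite [leLHS]big_mkcond; apply: ler_sum => w _; case: ifP => _; last exact: sumr_ge0.
  by rewrite [leLHS]big_mkcond; apply: ler_sum => w' _; case: ifP.
have E w : \sum_(w' < n) ((w == w')%:R * p + p ^+ 2) = p + n%:R * p ^+ 2.
  rewrite big_split /= sumr_const card_ord -[_ *+ n]mulr_natl -big_distrl /=.
  rewrite (bigD1 w) //= eqxx big1 ?addr0 ?mul1r // => w' ww.
  by rewrite eq_sym (negbTE ww).
under eq_bigr do rewrite E.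
rewrite sumr_const card_ord -[leLHS]mulr_natl.
have np0 : 0 <= n%:R * p by rewrite mulr_ge0.
have : 0 <= (2 - n%:R * p) * (2 + n%:R * p) by rewrite mulr_ge0 ?subr_ge0 ?addr_ge0.
by have := np; rewrite expr2; lra.
Qed.

(** The error terms of [distB_le_dist_BP], divided by [D]. *)
Definition err D L (A : graph) : R :=
  (#|short L A|)%:R + (2 * ((n %/ L).+1 * (2 * D).+1 * D))%:R
  + 2 / D%:R * \sum_v (deg A v ^ 2)%:R.

Lemma err_ge0 D L A : 0 <= err D L A.
Proof. by rewrite !addr_ge0 // mulr_ge0 ?divr_ge0 // sumr_ge0. Qed.

Lemma distB_le_err D L A : (0 < D)%N -> (0 < L)%N ->
  (distB A)%:R <= 3 * (dist_BP (tourn A))%:R + err D L A.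
Proof.
move=> D0 L0; have DR : 0 < D%:R :> R by rewrite ltr0n.
rewrite -(ler_pM2l DR) /err; have := distB_le_dist_BP A D L0.
move: (2 * ((n %/ L).+1 * (2 * D).+1 * D))%N => K.
rewrite -(ler_nat R) !(natrD, natrM) natr_sum.
move: (\sum_v _) (distB A)%:R (dist_BP _)%:R (#|_|)%:R => S b t h.
have -> : D%:R * (3 * t + (h + K%:R + 2 / D%:R * S)) =
  D%:R * (3 * t + h + K%:R) + 2 * S by field; rewrite gt_eqF.
by [].
Qed.

Lemma Ex_err D L : (0 < D)%N ->
  Ex p (pairs n) (err D L) set0 <=
  2 * L%:R + (2 * ((n %/ L).+1 * (2 * D).+1 * D))%:R + 12 / D%:R * n%:R.
Proof.
move=> D0; rewrite !ExD Ex_cst ExZ; apply: lerD; first by rewrite lerD2r Ex_short.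
rewrite Ex_sum; apply: (@le_trans _ _ (2 / D%:R * (6 * n%:R))); last by lra.
rewrite ler_wpM2l ?divr_ge0 //; apply: (@le_trans _ _ (\sum_(v < n) 6)).
  by apply: ler_sum => v _; apply: Ex_deg2.
by rewrite sumr_const card_ord mulr_natr.
Qed.

End ErrorTerm.

Lemma Ex_err_small (R : realType) (d : R) : 0 < d ->
  exists D L n0 : nat, [/\ (0 < D)%N, (0 < L)%N & forall (n : nat) (p : R),
    (n0 <= n)%N -> 0 <= p <= 1 / 2 -> n%:R * p <= 2 ->
    Ex p (pairs n) (err R D L) set0 <= d * n%:R].
Proof.
(* Each of three terms gets [d / 3]: first [D] makes [12 / D] small, then [L] is large compared with
   [D], then [n] with both. *)
move=> d0; have [D HD] := natr_gt_ex (36 / d).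
have D0 : (0 < D)%N.
  by rewrite -(ltr_nat R); apply: lt_trans (HD D (leqnn D)); rewrite divr_gt0.
have DR : 0 < D%:R :> R by rewrite ltr0n.
pose K := (2 * ((2 * D).+1 * D))%N.
have [L HL] := natr_gt_ex (3 * K%:R / d).
have [n0 Hn0] := natr_gt_ex (3 * (2 * L.+1%:R + K%:R) / d).
exists D, L.+1, n0; split=> // n p nn p2 np; apply: le_trans (Ex_err p2 np L.+1 D0) _.
have LR : 0 < L.+1%:R :> R by rewrite ltr0n.
have h1 : 12 / D%:R <= d / 3.
  by rewrite ler_pdivrMr //; have := HD D (leqnn D); rewrite ltr_pdivrMr // => /ltW; lra.
have h2 : (n %/ L.+1)%:R * K%:R <= d / 3 * n%:R.
  have : (n %/ L.+1)%:R * L.+1%:R <= n%:R :> R by rewrite -natrM ler_nat leq_divM.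
  have := HL L.+1 (leqnSn _); rewrite ltr_pdivrMr // => /ltW.
  have := ler0n R (n %/ L.+1).
  move: (n %/ L.+1)%:R n%:R L.+1%:R K%:R => a b l k a0 kl ab.
  by have := ler_wpM2l a0 kl; have := ler_wpM2r (ltW d0) ab; lra.
have h3 : 2 * L.+1%:R + K%:R <= d / 3 * n%:R.
  by have := Hn0 n nn; rewrite ltr_pdivrMr // => /ltW; lra.
have -> : (2 * ((n %/ L.+1).+1 * (2 * D).+1 * D))%N = ((n %/ L.+1) * K + K)%N.
  by rewrite /K -mulnA mulnCA -mulSnr mulnCA.
rewrite natrD natrM; have := ler_wpM2r (ler0n R n) h1; lra.
Qed.

Lemma dist_BP_chebyshev (R : realType) (n : nat) (p t : R) :
  0 <= p <= 1 -> n%:R * p <= 2 -> (0 < n)%N -> 0 < t ->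
  Pr p (fun A : {set 'I_n * 'I_n} => t * n%:R <=
    `|(dist_BP (tourn A))%:R - Ex p (pairs n) (fun A => (dist_BP (tourn A))%:R) set0|)
  <= 2 / (t ^+ 2 * n%:R).
Proof.
move=> p01 np n0 t0; have nR : 0 < n%:R :> R by rewrite ltr0n.
have tn : 0 < t * n%:R by rewrite mulr_gt0.
apply: le_trans (Ex_chebyshev (pairs n) set0 p01 tn _) _.
  by move=> e B; apply: dist_BP_lipschitz.
have p0 : 0 <= p by case/andP: p01.
rewrite ler_pdivrMr ?exprn_gt0 //.
have -> : 2 / (t ^+ 2 * n%:R) * (t * n%:R) ^+ 2 = 2 * n%:R.
  by field; rewrite !gt_eqF.
apply: (@le_trans _ _ (p * (n * n)%:R)); first by rewrite ler_wpM2l // ler_nat size_pairs.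
by rewrite natrM mulrA ler_wpM2r // mulrC.
Qed.

(** If [distB] exceeds [y n] and the error is below [y n / 2], then [3 * dist_BP] exceeds [y n / 2].
    The error is larger with probability at most [eps / 32], half of the probability available. *)
Lemma prob_dist_BP_lower (R : realType) (eps c : R) : 0 < eps -> eps < 1 ->
  c = 1 / (96 * (2000 * 25)) ->
  exists n0 : nat, forall n, (n0 <= n)%N ->
    eps / 32 <= Pr ((1 + eps) / n%:R)
      (fun A : {set 'I_n * 'I_n} => c / 6 * eps ^+ 3 * n%:R <= (dist_BP (tourn A))%:R).
Proof.
move=> e0 e1 cE; have c0 : 0 < c by rewrite cE; clear; lra.
have [n1 H1] := prob_distB_lower e0 e1; rewrite -cE in H1.
pose y := c * eps ^+ 3; have y0 : 0 < y by rewrite mulr_gt0 ?exprn_gt0.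
have d0 : 0 < y / 2 * (eps / 32) by rewrite !mulr_gt0 ?invr_gt0.
have [D [L [n2 [D0 L0 H2]]]] := Ex_err_small d0.
exists (maxn n1 (maxn n2 4)) => n; rewrite !geq_max => /and3P[nn1 nn2 n4'].
have n4 : 4 <= n%:R :> R by rewrite (ler_nat R 4).
have nR : 0 < n%:R :> R by apply: lt_le_trans n4.
have {}H1 := H1 n nn1; have {}H2 := H2 n ((1 + eps) / n%:R) nn2.
move: H1 H2; set p := (1 + eps) / n%:R => H1 H2.
have npE : n%:R * p = 1 + eps by rewrite /p mulrCA divff ?mulr1 // gt_eqF.
have np : n%:R * p <= 2 by rewrite npE; move: e1; clear; lra.
have p2 : 0 <= p <= 1 / 2.
  rewrite /p divr_ge0 ?ler_pdivrMr //=; last by move: e0; clear; lra.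
  by move: e1 n4; clear; lra.
have p01 : 0 <= p <= 1 by case/andP: p2 => -> /=; move=> h; apply: le_trans h _; clear; lra.
have yn : 0 < y / 2 * n%:R by rewrite mulr_gt0 // divr_gt0.
have M := Ex_markov (pairs n) set0 p01 yn (err_ge0 R D L).
have M' : Pr p (fun A : {set 'I_n * 'I_n} => y / 2 * n%:R <= err R D L A) <= eps / 32.
  apply: le_trans M _; rewrite ler_pdivrMr //; apply: le_trans (H2 p2 np) _.
  by rewrite le_eqVlt; apply/orP; left; apply/eqP; ring.
have : eps / 16 <= Pr p (fun A : {set 'I_n * 'I_n} =>
     c / 6 * eps ^+ 3 * n%:R <= (dist_BP (tourn A))%:R)
   + Pr p (fun A : {set 'I_n * 'I_n} => y / 2 * n%:R <= err R D L A).
  apply: le_trans H1 _; apply: Pr_leU => // A yA.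
  have := distB_le_err R A D0 L0; move: yA; rewrite -/y.
  case: (leP (y / 2 * n%:R)) => //=; rewrite ?orbT ?orbF // /y.
  by move: (err _ _ _ _) (distB _)%:R (dist_BP _)%:R (eps ^+ 3) => u v w z; clear; lra.
by move: M'; clear; lra.
Qed.

Lemma dist_BP_whp (R : realType) (eps c : R) : 0 < eps -> eps < 1 ->
  c = 1 / (96 * (2000 * 25)) ->
  exists (C : R) (n0 : nat), forall n, (n0 <= n)%N ->
    1 - C / n%:R <= Pr ((1 + eps) / n%:R) (fun A : {set 'I_n * 'I_n} =>
      (c / 24 * eps ^+ 3 * n%:R <= (dist_BP (tourn A))%:R) &&
      ((dist_BP (tourn A))%:R <= 61 * eps ^+ 3 * n%:R)) <= 1.
Proof.
move=> e0 e1 cE; have c0 : 0 < c by rewrite cE; clear; lra.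
have c1 : c <= 1 by rewrite cE; clear; lra.
pose y := c * eps ^+ 3; have e3 : 0 < eps ^+ 3 by rewrite exprn_gt0.
have y0 : 0 < y by rewrite mulr_gt0.
have ye : y <= eps ^+ 3 by rewrite ler_piMl // ltW.
pose t := y / 24; have t0 : 0 < t by rewrite divr_gt0.
have [n1 H1] := expected_distB_upper e0 e1.
have [n2 H2] := prob_dist_BP_lower e0 e1 cE.
have [n3 H3] := natr_gt_ex (2 / t ^+ 2 * (32 / eps)).
exists (2 / t ^+ 2), (maxn n1 (maxn n2 (maxn n3 4))) => n.
rewrite !geq_max => /and4P[nn1 nn2 nn3 n4'].
have n4 : 4 <= n%:R :> R by rewrite (ler_nat R 4).
have nR : 0 < n%:R :> R by apply: lt_le_trans n4.
have n0 : (0 < n)%N by apply: leq_trans n4'.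
have {}H1 := H1 n nn1; have {}H2 := H2 n nn2; have {}H3 := H3 n nn3.
move: H1 H2; set p := (1 + eps) / n%:R => H1 H2.
have npE : n%:R * p = 1 + eps by rewrite /p mulrCA divff ?mulr1 // gt_eqF.
have np : n%:R * p <= 2 by rewrite npE; move: e1; clear; lra.
have p2 : 0 <= p <= 1 / 2.
  rewrite /p divr_ge0 ?ler_pdivrMr //=; last by move: e0; clear; lra.
  by move: e1 n4; clear; lra.
have p01 : 0 <= p <= 1 by case/andP: p2 => -> /=; move=> h; apply: le_trans h _; clear; lra.
have := dist_BP_chebyshev p01 np n0 t0.
set m := Ex p (pairs n) _ set0 => Ch.
have m1 : m <= 60 * eps ^+ 3 * n%:R.
  apply: le_trans H1; apply: Ex_le => // A; rewrite ler_nat; exact: dist_BP_le_distB.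
have t0n : 0 < t * n%:R by rewrite mulr_gt0.
have c6 : c / 6 * eps ^+ 3 = 4 * t by rewrite /t /y; field.
have m2 : 2 * t * n%:R <= m.
  (* If the mean were below [2 t n], reaching [4 t n] would be a deviation of more than [t n]; its
     probability, at least [eps / 32], would contradict the Chebyshev bound for large [n]. *)
  rewrite leNgt; apply/negP => mt.
  have : eps / 32 <= 2 / (t ^+ 2 * n%:R).
    apply: le_trans H2 _; apply: le_trans Ch; apply: (Pr_le p2) => A.
    rewrite c6 => dA; apply: le_trans (ler_norm _).
    by move: mt dA t0n; move: (dist_BP _)%:R => d; clear; lra.
  rewrite leNgt => /negP; apply.
  have t2 : 0 < t ^+ 2 by apply: exprn_gt0.
  have te : 0 < t ^+ 2 * (eps / 32) by apply: mulr_gt0 t2 _; apply: divr_gt0.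
  rewrite ltr_pdivrMr ?(mulr_gt0 t2 nR) //; have := H3; rewrite -(ltr_pM2l te).
  have -> : t ^+ 2 * (eps / 32) * (2 / t ^+ 2 * (32 / eps)) = 2 by field; rewrite !gt_eqF.
  by move=> h; apply: lt_le_trans h _; rewrite le_eqVlt; apply/orP; left; apply/eqP; ring.
apply/andP; split; last exact: Pr_le1.
have c24 : c / 24 * eps ^+ 3 = t by rewrite /t /y; field.
rewrite c24; set G := Pr p _.
suff : 1 <= G + 2 / (t ^+ 2 * n%:R).
  have -> : 2 / (t ^+ 2 * n%:R) = 2 / t ^+ 2 / n%:R by field; rewrite !gt_eqF.
  by clear; lra.
apply: le_trans (_ : G + Pr p (fun A : {set 'I_n * 'I_n} =>
  t * n%:R <= `|(dist_BP (tourn A))%:R - m|) <= _); last by rewrite lerD2l.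
apply: (@le_trans _ _ (Pr p (fun _ : {set 'I_n * 'I_n} => true))).
  by rewrite /Pr Ex_cst.
apply: (Pr_leU p2) => A _.
case: (leP (t * n%:R) `|_ - m|) => //=; rewrite ?orbT ?orbF //.
have tn3 : t * n%:R <= eps ^+ 3 * n%:R.
  by rewrite ler_wpM2r ?ltW // /t; move: ye y0; clear; lra.
(* Within [t n] of a mean between [2 t n] and [60 * eps ^ 3 * n], the distance is at least [t n] and
   at most [61 * eps ^ 3 * n]. *)
rewrite ltr_norml => /andP[]; move: (dist_BP _)%:R m1 m2 tn3; clear => d m1 m2 tn3 d1 d2.
by apply/andP; split; lra.
Qed.

(* Passage to the limit in [n] *)
From mathcomp Require Import all_classical all_reals all_analysis.
Import numFieldNormedType.Exports.

Local Open Scope classical_set_scope.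

Theorem theorem1p6 (R : realType) :
  exists c1 c2 : R, [/\ 0 < c1, c1 <= c2 &
    forall eps : R, 0 < eps -> eps < 1 ->
      (fun n : nat => tour_prob ((1 + eps) / n%:R)
         (fun T : tournament 'I_n =>
            (c1 * eps ^+ 3 * n%:R <= (dist_BP T)%:R) &&
            ((dist_BP T)%:R <= c2 * eps ^+ 3 * n%:R)))
        @ \oo --> (1 : R)].
Proof.
have [c cE] : exists c : R, c = 1 / (96 * (2000 * 25)) by eexists.
have c0 : 0 < c by rewrite cE; clear; lra.
have c1 : c <= 1 by rewrite cE; clear; lra.
exists (c / 24), 61; split; [exact: divr_gt0|by lra|].
move=> eps e0 e1; have [C [n0 H]] := dist_BP_whp e0 e1 cE.
apply/cvgrPdist_le => d d0; have [n1 H1] := natr_gt_ex (C / d).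
exists (maxn n0 (maxn n1 1)) => // n /=; rewrite !geq_max => /and3P[nn0 /H1 {}H1 n1'].
have nR : 0 < n%:R :> R by rewrite ltr0n.
rewrite tour_probE; have /andP[] := H n nn0; rewrite /Pr => G0 G1.
rewrite ger0_norm ?subr_ge0 //; apply: le_trans (_ : C / n%:R <= _).
  by move: G0; clear; lra.
by rewrite ler_pdivrMr // mulrC -ler_pdivrMr // ltW.
Qed.
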